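(* A random cubic graph almost surely is not homomorphic to $C_7$. That is, if $G_n$ denotes a graph chosen uniformly at random among all (simple) cubic graphs on $n$ vertices ($n$ even), then $\Pr[\text{there exists a homomorphism from } G_n \text{ to } C_7] \to 0$ as $n\to\infty$.
   Context: $C_7$ is the cycle on 7 vertices. A homomorphism from a graph $G$ to a graph $H$ is a map $h:V(G)\to V(H)$ such that $h(x)h(y)$ is an edge of $H$ for every edge $xy$ of $G$. A cubic graph is a 3-regular graph. *)

(* Defs.v *)
From mathcomp Require Import all_boot all_order all_algebra.
Set Implicit Arguments.
Unset Strict Implicit.
Unset Printing Implicit Defensive.

(* A graph on the vertex type T is given by its set of edges; x and y are     *)
(* adjacent when [set x; y] is an edge. In a simple graph every edge has      *)
(* exactly two ends, which excludes loops since [set x; x] = [set x].         *)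
Definition simple_graph (T : finType) (E : {set {set T}}) : bool :=
  [forall e in E, #|e| == 2].

Definition degree (T : finType) (E : {set {set T}}) (v : T) : nat :=
  #|[set e in E | v \in e]|.

Definition cubic (T : finType) (E : {set {set T}}) : bool :=
  simple_graph E && [forall v, degree E v == 3].

Definition is_hom (T U : finType) (E : {set {set T}}) (F : {set {set U}})
    (h : {ffun T -> U}) : bool :=
  [forall x, forall y, ([set x; y] \in E) ==> ([set h x; h y] \in F)].

Definition homomorphic (T U : finType) (E : {set {set T}})
    (F : {set {set U}}) : bool :=
  [exists h : {ffun T -> U}, is_hom E F h].

(* ordS is the successor modulo n, so this is the usual cycle for n >= 3.     *)
Definition cycle_graph (n : nat) : {set {set 'I_n}} :=
  [set [set i; ordS i] | i : 'I_n].

Definition cubic_graphs (n : nat) : {set {set {set 'I_n}}} :=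
  [set E | cubic E].

(* Probability of the event A under the uniform distribution on the nonempty  *)
(* finite set Omega; the junk value is 0 when Omega is empty.                 *)
Definition uniform_prob (R : numFieldType) (T : finType)
    (Omega A : {set T}) : R :=
  (#|Omega :&: A|%:R / #|Omega|%:R)%R.

Definition prob_cubic_hom (R : numFieldType) (n : nat) (U : finType)
    (F : {set {set U}}) : R :=
  uniform_prob R (cubic_graphs n) [set E | homomorphic E F].

(* Main.v *)
(* The first moment of the number of homomorphisms to C_7 is exponentially
   large, so homomorphisms are counted with weights.  A vertex all of whose
   neighbours have the same colour can be recoloured; weighting a homomorphism
   by 2^-(number of such vertices) still gives every graph that has a
   homomorphism a total weight of at least 1, since for every nonempty set S of
   functions the sum over h in S of 2^-(number of coordinates in which h can be
   changed inside S) is at least 1.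

   Let n = 2m, and let e_i be the number of edges between the colours i and
   i + 1.  Each vertex has 3 half-edges, each going to the next or to the
   previous colour, and the weight turns the generating function (x + y)^3 of a
   vertex into (x + y)^3 - (x^3 + y^3)/2 <= 7/8 (x + y)^3.  After division by
   the number of cubic graphs the weighted first moment is, up to a polynomial
   factor, at most the maximum over s >= 0 of ((7/8)^2 (2Q)^3 / N^4)^m with
   N = sum s_i^3 and Q = sum s_i^2 s_(i+1)^2.

   At a maximum of Q on N = 1 one has s_(i-1)^2 + s_(i+1)^2 = 2Q s_i.
   After rescaling to s_(i-1)^2 + s_(i+1)^2 = s_i one needs N > (7/8)^2 for
   every nonzero cyclic solution.  All coordinates are determined by the
   largest one and one of its neighbours, and a subdivision of this
   two-parameter domain shows N >= 0.766.

   The number of cubic graphs is bounded from below by double counting: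
   subdividing two distinct edges and joining the two new vertices turns a
   cubic graph on n vertices into one on n + 2 vertices with a marked edge. *)

From Stdlib Require Import NArith.
Require Import Defs.
From mathcomp Require Import all_boot all_order all_algebra.
From mathcomp Require Import zify ring lra.
Set Implicit Arguments.
Unset Strict Implicit.
Unset Printing Implicit Defensive.
Import Order.TTheory GRing.Theory Num.Theory.

(** * A lower bound on the number of cubic graphs *)

Section Subdivision.
Variable T : finType.
Implicit Types (E : {set {set T}}) (e f A : {set T}) (u v x y : T).

(** Graphs on [n] and on [n + 2] vertices have to live on one vertex type, so a smaller graph is
    encoded with isolated vertices outside [A]. *)
Definition cubic_on A E :=
  simple_graph E && [forall v, degree E v == if v \in A then 3 else 0].

Lemma simple_graphP E : reflect {in E, forall e, #|e| = 2} (simple_graph E).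
Proof.
apply: (iffP forall_inP) => H e eE; first exact/eqP/H.
by apply/eqP/H.
Qed.

Lemma degreeE E v : degree E v = \sum_(e in E) (v \in e).
Proof.
rewrite /degree -sum1_card big_mkcond [RHS]big_mkcond /=.
by apply: eq_bigr => e _; rewrite inE; case: (e \in E); case: (v \in e).
Qed.

Lemma cubic_on_edge A E e x : cubic_on A E -> e \in E -> x \in e -> x \in A.
Proof.
case/andP=> _ /forallP /(_ x); case: (x \in A) => //.
rewrite /degree cards_eq0 => /eqP E0 eE xe.
by move/setP: E0 => /(_ e); rewrite !inE eE xe.
Qed.

Lemma cubic_on_card A E : cubic_on A E -> 2 * #|E| = 3 * #|A|.
Proof.
case/andP=> /simple_graphP sE /forallP dE.
have -> : 3 * #|A| = \sum_v degree E v.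
  rewrite (eq_bigr (fun v => if v \in A then 3 else 0)); last by move=> v _; apply/eqP.
  by rewrite -big_mkcond sum_nat_const mulnC.
under eq_bigr => v _ do rewrite degreeE.
rewrite exchange_big /= mulnC -sum_nat_const; apply: eq_bigr => e eE.
rewrite -(sE e eE) -sum1_card big_mkcond /=.
by apply: eq_bigr => x _; case: (x \in e).
Qed.

Lemma sum_disjointU (A B : {set {set T}}) (F : {set T} -> nat) : [disjoint A & B] ->
  \sum_(e in A :|: B) F e = \sum_(e in A) F e + \sum_(e in B) F e.
Proof. by move=> AB; rewrite -bigU //; apply: eq_bigl => e; rewrite !inE. Qed.

Definition star v e : {set {set T}} := [set [set v; x] | x in e].

Lemma set2_inj v : {in [set~ v] &, injective (fun x => [set v; x])}.
Proof.
move=> x y; rewrite !inE => xv yv /setP /(_ x).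
by rewrite !inE eqxx orbT (negPf xv) /= => /esym /eqP.
Qed.

Lemma sum_star v e (F : {set T} -> nat) : v \notin e ->
  \sum_(e' in star v e) F e' = \sum_(x in e) F [set v; x].
Proof.
move=> ve; rewrite big_imset //= => x y xe ye.
by apply: set2_inj; rewrite !inE; [apply: contraNneq ve => <- | apply: contraNneq ve => <-].
Qed.

(** [star u e] consists of the two halves of [e] once [u] has been placed on it; [v] is placed on
    [f] in the same way. *)
Definition subdivide E u v e f :=
  (E :\ e :\ f) :|: (star u e :|: (star v f :|: [set [set u; v]])).

Section Fixed.
Variables (E : {set {set T}}) (u v : T) (e f : {set T}).
Hypotheses (uv : u != v) (cE : cubic_on (~: [set u; v]) E).
Hypotheses (eE : e \in E) (fE : f \in E) (ef : e != f).

Let inE_out e' : e' \in E -> (u \notin e') /\ (v \notin e').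
Proof.
move=> e'E; split; apply/negP=> /(cubic_on_edge cE e'E); rewrite !inE eqxx //.
by rewrite orbT.
Qed.

Let ue : u \notin e := proj1 (inE_out eE).
Let ve : v \notin e := proj2 (inE_out eE).
Let uf : u \notin f := proj1 (inE_out fE).
Let vf : v \notin f := proj2 (inE_out fE).

(** The four families of edges are disjoint since [u] and [v] meet no edge of [E]. With an incidence
    indicator for [F] this yields the degrees. *)
Lemma sum_subdivide (F : {set T} -> nat) :
  \sum_(e' in subdivide E u v e f) F e' =
  \sum_(e' in E :\ e :\ f) F e' + (\sum_(x in e) F [set u; x] +
   (\sum_(x in f) F [set v; x] + F [set u; v])).
Proof.
rewrite /subdivide sum_disjointU /=; last first.
  rewrite disjoints_subset; apply/subsetP => e'; rewrite 4!inE => /andP[_ /andP[_ e'E]].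
  have [un vn] := inE_out e'E.
  rewrite inE; apply/negP; rewrite !inE => /orP[|/orP[]].
  - by case/imsetP=> x _ E1; rewrite E1 !inE eqxx in un.
  - by case/imsetP=> x _ E1; rewrite E1 !inE eqxx in vn.
  - by move/eqP=> E1; rewrite E1 !inE eqxx in un.
rewrite sum_disjointU /=; last first.
  rewrite disjoints_subset; apply/subsetP => e' /imsetP[x xe ->].
  rewrite inE; apply/negP; rewrite !inE => /orP[].
    case/imsetP=> y yf /setP /(_ u); rewrite !inE eqxx (negPf uv) /= => /esym /eqP uy.
    by move: uf; rewrite uy yf.
  move=> /eqP /setP /(_ v); rewrite !inE eqxx orbT eq_sym (negPf uv) /= => /eqP vx.
  by move: ve; rewrite vx xe.
rewrite sum_disjointU /=; last first.
  rewrite disjoints_subset; apply/subsetP => e' /imsetP[x xf ->].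
  rewrite !inE; apply/eqP => /setP /(_ u); rewrite !inE eqxx (negPf uv) /= => /eqP ux.
  by move: uf; rewrite ux xf.
by rewrite !sum_star // big_set1.
Qed.

Lemma subdivide_cubic : cubic (subdivide E u v e f).
Proof.
have [/simple_graphP sE /forallP dE] := andP cE.
apply/andP; split.
  apply/simple_graphP => e'; rewrite !inE => /orP[/and3P[_ _ /sE //]|].
  case/orP=> [/imsetP[x xe ->]|/orP[/imsetP[x xf ->]|/eqP ->]]; rewrite cards2.
  - by rewrite (_ : u != x) //; apply: contraNneq ue => ->.
  - by rewrite (_ : v != x) //; apply: contraNneq vf => ->.
  - by rewrite uv.
apply/forallP => x; rewrite degreeE sum_subdivide.
have fEe : f \in E :\ e by rewrite !inE eq_sym ef.
have := dE x; rewrite degreeE (big_setD1 e) //= (big_setD1 f) //= !inE.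
set r := \sum_(e' in _ :\ f) _.
have sum1 (z : T) (a : {set T}) : z != x -> \sum_(y in a) (x \in [set z; y]) = (x \in a).
  move=> zx; rewrite (eq_bigr (fun y => (y == x) : nat)); last first.
    by move=> y _; rewrite !inE eq_sym (negPf zx) eq_sym.
  case xa: (x \in a).
    by rewrite (bigD1 x) //= eqxx big1 // => y /andP[_ /negPf ->].
  by rewrite big1 // => y ya; case: eqP ya => // ->; rewrite xa.
have sum2 (z : T) (a : {set T}) : \sum_(y in a) (z \in [set z; y]) = #|a|.
  by rewrite -sum1_card; apply: eq_bigr => y _; rewrite !inE eqxx.
have [xu|xu] := eqVneq x u.
  rewrite {x sum1}xu in r *; rewrite sum2 (negPf ue) (negPf uf) (sE e eE) /= !add0n.
  move=> /eqP ->; rewrite big1 ?inE ?eqxx // => y yf.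
  by rewrite !inE (negPf uv) /=; apply/eqP; rewrite eqb0; apply: contraNneq uf => ->.
have [xv|xv] := eqVneq x v.
  rewrite {x sum1 xu}xv in r *; rewrite sum2 (negPf ve) (negPf vf) (sE f fE) /= !add0n.
  move=> /eqP ->; rewrite big1 ?inE ?eqxx ?orbT // => y ye.
  by rewrite !inE eq_sym (negPf uv) /=; apply/eqP; rewrite eqb0; apply: contraNneq ve => ->.
move=> /= /eqP <-; rewrite (sum1 u) 1?(eq_sym u) // (sum1 v) 1?(eq_sym v) //.
by rewrite addn0 addnC addnA.
Qed.

Lemma adj_subdivide : [set u; v] \in subdivide E u v e f.
Proof. by rewrite !inE eqxx !orbT. Qed.

Let adj_u x : [set u; x] \in subdivide E u v e f = (x \in v |: e).
Proof.
rewrite !inE; apply/idP/idP.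
  case/orP=> [/and3P[_ _ /inE_out[]]|/orP[/imsetP[y ye]|/orP[/imsetP[y yf]|]]].
  - by rewrite !inE eqxx.
  - move=> E1; have : y \in [set u; x] by rewrite E1 !inE eqxx orbT.
    by rewrite !inE => /orP[] /eqP yE; move: ye; rewrite yE ?(negPf ue) // => ->; rewrite orbT.
  - move=> /setP /(_ u); rewrite !inE eqxx (negPf uv) /= => /esym /eqP uy.
    by move: uf; rewrite uy yf.
  - move=> /eqP E1; have : v \in [set u; x] by rewrite E1 !inE eqxx orbT.
    by rewrite !inE eq_sym (negPf uv) /= eq_sym => ->.
case/orP=> [/eqP->|xe]; first by rewrite eqxx !orbT.
by apply/orP; right; apply/orP; left; apply/imsetP; exists x.
Qed.

Let adj_v x : [set v; x] \in subdivide E u v e f = (x \in u |: f).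
Proof.
rewrite !inE; apply/idP/idP.
  case/orP=> [/and3P[_ _ /inE_out[]]|/orP[/imsetP[y ye]|/orP[/imsetP[y yf]|]]].
  - by rewrite !inE eqxx.
  - move=> /setP /(_ v); rewrite !inE eqxx (eq_sym v u) (negPf uv) /= => /esym /eqP vy.
    by move: ve; rewrite vy ye.
  - move=> E1; have : y \in [set v; x] by rewrite E1 !inE eqxx orbT.
    by rewrite !inE => /orP[] /eqP yE; move: yf; rewrite yE ?(negPf vf) // => ->; rewrite orbT.
  - move=> /eqP E1; have : u \in [set v; x] by rewrite E1 !inE eqxx.
    by rewrite !inE (negPf uv) /= eq_sym => ->.
case/orP=> [/eqP->|xf]; first by rewrite setUC eqxx !orbT.
by apply/orP; right; apply/orP; right; apply/orP; left; apply/imsetP; exists x.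
Qed.

(** Inverse of the subdivision for a known pair of new vertices: the ends of [e] are the neighbours
    of [u] other than [v], and likewise for [f]. *)
Definition unsubdivide (E' : {set {set T}}) (u v : T) : {set {set T}} * {set T} * {set T} :=
  let e := [set x | [set u; x] \in E'] :\ v in
  let f := [set x | [set v; x] \in E'] :\ u in
  ([set e' in E' | (u \notin e') && (v \notin e')] :|: [set e; f], e, f).

Lemma subdivideK : unsubdivide (subdivide E u v e f) u v = (E, e, f).
Proof.
rewrite /unsubdivide.
have -> : [set x | [set u; x] \in subdivide E u v e f] :\ v = e.
  apply/setP=> x; rewrite 3!inE adj_u !inE.
  by case: eqVneq => //= ->; rewrite (negPf ve).
have -> : [set x | [set v; x] \in subdivide E u v e f] :\ u = f.
  apply/setP=> x; rewrite 3!inE adj_v !inE.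
  by case: eqVneq => //= ->; rewrite (negPf uf).
congr (_, _, _); apply/setP=> e'; rewrite !inE.
have [->|e'e] := eqVneq e' e; first by rewrite eE orbT.
have [->|e'f] := eqVneq e' f; first by rewrite fE !orbT.
rewrite !orbF /=; apply/andP/idP => [[]|e'E]; last by rewrite e'E; have [-> ->] := inE_out e'E.
case/orP=> [//|/orP[/imsetP[y _ ->]|/orP[/imsetP[y _ ->]|/eqP ->]]];
  by rewrite !inE eqxx ?andbF.
Qed.
End Fixed.
End Subdivision.

Section Neighbours.
Variable T : finType.
Implicit Types (E : {set {set T}}) (v w : T).

Definition nbrs E v : {set T} := [set w | [set v; w] \in E].

Lemma nbrsC E v w : (w \in nbrs E v) = (v \in nbrs E w).
Proof. by rewrite !inE setUC. Qed.

Lemma nbrs_neq E v w : simple_graph E -> w \in nbrs E v -> w != v.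
Proof.
move=> /simple_graphP sE; rewrite inE => /sE.
by rewrite cards2 eq_sym; case: eqP.
Qed.

Lemma card_nbrs E v : simple_graph E -> #|nbrs E v| = degree E v.
Proof.
move=> sE; rewrite /degree -(card_in_imset (f := fun w => [set v; w])); last first.
  by move=> x y xv yv; apply: set2_inj; rewrite !inE (nbrs_neq sE).
apply: eq_card => e; rewrite inE; apply/imsetP/andP => [[w]|[eE ve]].
  by rewrite inE => wE ->; rewrite wE !inE eqxx.
have /eqP := simple_graphP _ sE e eE.
rewrite (cardsD1 v) ve => /cards1P[w Ew].
have eq : e = [set v; w] by rewrite -[LHS](setD1K ve) Ew.
by exists w; rewrite // inE -eq.
Qed.

Lemma cubic_nbrs E v : cubic E -> #|nbrs E v| = 3.
Proof. by case/andP=> sE /forallP /(_ v) /eqP <-; apply: card_nbrs. Qed.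
End Neighbours.

Lemma card_cubic_relabel (S T : finType) (h : S -> T) : injective h ->
  #|[set E : {set {set S}} | cubic E]| <= #|[set E | cubic_on (h @: [set: S]) E]|.
Proof.
move=> h_inj; have hh_inj : injective (fun e : {set S} => h @: e) by exact: imset_inj.
rewrite -(card_imset _ (imset_inj hh_inj)) subset_leq_card //.
apply/subsetP => E1 /imsetP[E]; rewrite inE => /andP[/simple_graphP sE /forallP dE] ->{E1}.
rewrite inE; apply/andP; split.
  by apply/simple_graphP => _ /imsetP[e eE ->]; rewrite card_imset // sE.
apply/forallP => x; rewrite degreeE big_imset /=; last by move=> ? ? _ _; apply: hh_inj.
case: ifP => [/imsetP[y _ ->]|xh].
  rewrite -(eqP (dE y)) degreeE; apply/eqP/eq_bigr => e _.
  by rewrite mem_imset.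
rewrite big1 // => e _; case: imsetP => // -[y _ xy].
by move: xh; rewrite xy imset_f ?inE.
Qed.

Lemma card_le_inj_in (S T : finType) (A : {pred S}) (B : {pred T}) (f : S -> T) :
  {in A &, injective f} -> {in A, forall x, f x \in B} -> #|A| <= #|B|.
Proof.
move=> f_inj fAB; rewrite -(card_in_image f_inj); apply: subset_leq_card.
by apply/subsetP => _ /imageP[x xA ->]; apply: fAB.
Qed.

Lemma card_dep_pairs (S T : finType) (P : pred S) (Q : S -> pred T) :
  #|[pred t : S * T | P t.1 && Q t.1 t.2]| = \sum_(x | P x) #|Q x|.
Proof.
rewrite -sum1_card -(pair_big_dep P Q (fun _ _ => 1)) /=.
by apply: eq_bigr => x _; rewrite sum1_card.
Qed.

(** Two ordered new vertices, a cubic graph on the other [n = 2m] vertices and an ordered pair of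
    distinct edges map injectively to a cubic graph with an ordered adjacent pair. There are at
    least [(n + 2)(n + 1) 3m (3m - 1)] sources per graph on [n] vertices and exactly [3(n + 2)]
    pairs per target graph. *)
Lemma card_cubic_step m :
  m * m.*2.+1 * (3 * m).-1 * #|cubic_graphs m.*2| <= #|cubic_graphs m.*2.+2|.
Proof.
set n := m.*2; pose T := 'I_n.+2.
pose tT := ((T * T) * ({set {set T}} * ({set T} * {set T})))%type.
pose X3 (E : {set {set T}}) := [pred t : {set T} * {set T} | (t.1 \in E) && (t.2 \in E :\ t.1)].
pose X2 (p : T * T) := [pred t : {set {set T}} * ({set T} * {set T}) |
  cubic_on (~: [set p.1; p.2]) t.1 && X3 t.1 t.2].
pose X := [pred t : tT | (t.1.1 != t.1.2) && X2 t.1 t.2].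
pose Y := [pred t : {set {set T}} * (T * T) | let: (E, (u, v)) := t in cubic E && (v \in nbrs E u)].
have XY : #|X| <= #|Y|.
  pose F (t : tT) := let: (p, (E, (e, f))) := t in (subdivide E p.1 p.2 e f, p).
  apply: (@card_le_inj_in _ _ X Y F).
    move=> [[u v] [E [e f]]] [[u' v'] [E' [e' f']]] /=.
    rewrite !inE /= => /and5P[uv cE eE fe fE] /and5P[uv' cE' eE' fe' fE'] [Es uu vv].
    rewrite -{}uu -{}vv in uv' cE' Es *.
    have := subdivideK uv cE eE fE; rewrite Es subdivideK //.
    by case=> -> -> ->.
  move=> [[u v] [E [e f]]]; rewrite unfold_in /= => /and4P[uv cE eE].
  rewrite in_setD1 => /andP[fe fE]; rewrite unfold_in /=; apply/andP; split.
    by apply: subdivide_cubic => //; rewrite eq_sym.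
  by rewrite inE adj_subdivide.
have cY : #|Y| = 3 * n.+2 * #|cubic_graphs n.+2|.
  rewrite (eq_card (B := [pred t : {set {set T}} * (T * T) |
    cubic t.1 && [pred p : T * T | (p.1 \in T) && (p.2 \in nbrs t.1 p.1)] t.2]));
    last by case=> E [u v].
  rewrite (card_dep_pairs _ (fun E => [pred p : T * T | (p.1 \in T) && (p.2 \in nbrs E p.1)])).
  rewrite (eq_bigr (fun=> 3 * n.+2)); last first.
    move=> E cE; rewrite (card_dep_pairs _ (fun u => mem (nbrs E u))).
    rewrite (eq_bigr (fun=> 3)); first by rewrite sum_nat_const card_ord mulnC.
    by move=> u _; rewrite cubic_nbrs.
  by rewrite sum_nat_const mulnC cardsE.
have cX : n.+2 * n.+1 * (3 * m * (3 * m).-1) * #|cubic_graphs n| <= #|X|.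
  have -> : #|X| = \sum_(p : T * T | p.1 != p.2) #|X2 p|.
    exact: (card_dep_pairs (fun p : T * T => p.1 != p.2) (fun p => X2 p)).
  apply: (@leq_trans (\sum_(p : T * T | p.1 != p.2) 3 * m * (3 * m).-1 * #|cubic_graphs n|)).
    rewrite sum_nat_const -mulnA leq_mul2r; apply/orP; right.
    rewrite (card_dep_pairs predT (fun u v => u != v)).
    rewrite (eq_bigr (fun=> n.+1)); first by rewrite sum_nat_const card_ord.
    move=> u _; transitivity #|predC1 u|; last by rewrite cardC1 card_ord.
    by apply: eq_card => v; rewrite !inE eq_sym.
  apply: leq_sum; case=> u v /= uv.
  have -> : #|X2 (u, v)| = \sum_(E | cubic_on (~: [set u; v]) E) #|X3 E|.
    exact: (card_dep_pairs (cubic_on (~: [set u; v])) (fun E => X3 E)).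
  have cA : #|~: [set u; v]| = n by rewrite cardsCs setCK cards2 uv card_ord !subSS subn0.
  rewrite (eq_bigr (fun=> 3 * m * (3 * m).-1)); last first.
    move=> E cE; 
    have -> : #|X3 E| = \sum_(e in E) #|E :\ e|.
      exact: (card_dep_pairs (mem E) (fun e => mem (E :\ e))).
    have cardE : #|E| = 3 * m by move: (cubic_on_card cE); rewrite cA /n; lia.
    rewrite (eq_bigr (fun=> (3 * m).-1)); first by rewrite sum_nat_const cardE.
    by move=> e eE; move: cardE; rewrite (cardsD1 e) eE => <-.
  rewrite sum_nat_const mulnC leq_mul2r; apply/orP; right.
  have A_gt i : (i < n) -> i < #|~: [set u; v]| by rewrite cA.
  pose h (i : 'I_n) : T := enum_val (Ordinal (A_gt i (ltn_ord i))).
  have h_inj : injective h by move=> i j /enum_val_inj [/val_inj].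
  have -> : ~: [set u; v] = h @: [set: 'I_n].
    apply/esym/eqP; rewrite eqEcard card_imset // cA cardsT card_ord leqnn andbT.
    by apply/subsetP => _ /imsetP[i _ ->]; apply: enum_valP.
  by rewrite (leq_trans (card_cubic_relabel h_inj)) // cardsE.
have := leq_trans cX XY; rewrite {}cY /n => le.
rewrite -(leq_pmul2l (_ : 0 < 3 * m.*2.+2)) // (leq_trans _ le) //.
by apply/eq_leq; lia.
Qed.

Lemma cubic_graphs4 : 0 < #|cubic_graphs 4|.
Proof.
apply/card_gt0P; exists [set e : {set 'I_4} | #|e| == 2]; rewrite inE.
have sK : simple_graph [set e : {set 'I_4} | #|e| == 2].
  by apply/simple_graphP => e; rewrite inE => /eqP.
rewrite /cubic sK; apply/forallP => v; rewrite -card_nbrs //.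
rewrite (eq_card (B := predC1 v)) ?cardC1 ?card_ord // => w.
by rewrite !inE cards2 (eq_sym w); case: (v == w).
Qed.

(** By induction: the recursion factor [m(2m + 1)(3m - 1)] falls short of [6(m + 1)^3], and the
    growth from [m^4] to [(m + 1)^4] makes up for it. The constant 18 is such that a single graph,
    K_4, suffices at [m = 2]. *)
Lemma card_cubic_lower_bound m : 1 < m ->
  6 ^ m * m`! ^ 3 <= 18 * m ^ 4 * #|cubic_graphs m.*2|.
Proof.
elim: m => // m IHm; rewrite ltnS leq_eqVlt => /predU1P[<-|m_gt1].
  by rewrite (_ : _ * _ ^ 3 = 288) // leq_pmulr // cubic_graphs4.
have {}IHm := IHm m_gt1.
have step := card_cubic_step m; rewrite doubleS.
set g := #|_| in IHm step; set g' := #|_| in step *.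
have poly : 6 * m ^ 4 <= m.+1 * (m * m.*2.+1 * (3 * m).-1).
  case: m m_gt1 {IHm step g g'} => // k _.
  by rewrite -muln2 !expnS expn0 mulnS /=; lia.
rewrite factS expnS expnMn.
have -> : 6 * 6 ^ m * (m.+1 ^ 3 * m`! ^ 3) = 6 * m.+1 ^ 3 * (6 ^ m * m`! ^ 3).
  by rewrite mulnACA.
apply: leq_trans (leq_mul (leqnn (6 * m.+1 ^ 3)) IHm) _.
have -> : 6 * m.+1 ^ 3 * (18 * m ^ 4 * g) = 18 * m.+1 ^ 3 * (6 * m ^ 4 * g).
  by move: (m.+1 ^ 3) (m ^ 4) => a b; lia.
rewrite [m.+1 ^ 4]expnSr [18 * (_ * _)]mulnA -[18 * _ * m.+1 * g']mulnA leq_mul2l; apply/orP; right.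
apply: (@leq_trans (m.+1 * (m * m.*2.+1 * (3 * m).-1) * g)).
  by rewrite leq_mul2r poly orbT.
by rewrite -mulnA leq_mul2l step orbT.
Qed.

(** * Weighted homomorphisms *)

Local Open Scope ring_scope.

Section FlippableCoordinates.
Variables (R : realFieldType) (T U : finType).
Implicit Types (S : {set {ffun T -> U}}) (h : {ffun T -> U}) (A : {set T}).

Definition flippable S h (v : T) : bool :=
  [exists h' in S, (h' != h) && [forall w, (w != v) ==> (h' w == h w)]].

Lemma flippableP S h v : reflect
  (exists h', [/\ h' \in S, h' v != h v & forall w, w != v -> h' w = h w]) (flippable S h v).
Proof.
apply: (iffP exists_inP) => [[h' h'S /andP[h'h /forallP eq]]|[h' [h'S h'v eq]]]; exists h' => //.
  have eq' w : w != v -> h' w = h w by move=> wv; apply/eqP; move: (eq w); rewrite wv.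
  split=> //; apply: contraNneq h'h => hv; apply/eqP/ffunP => w.
  by have [->|/eq'] := eqVneq w v.
apply/andP; split; first by apply: contraNneq h'v => ->.
by apply/forallP => w; apply/implyP => /eq ->.
Qed.

Let wt A S h : R := 2^-1 ^+ #|[set v in A | flippable S h v]|.

Let wt_ge0 A S h : 0 <= wt A S h.
Proof. by rewrite exprn_ge0 // invr_ge0. Qed.

(** Induction on the set [A] of coordinates in which members of [S] may differ. [S] is sliced by the
    value at one [v] in [A], and each nonempty slice has total weight at least 1 in its own
    right. *)
Lemma sum_flippable_weight_on A S h0 : h0 \in S ->
  {in S &, forall h h', forall w, w \notin A -> h w = h' w} ->
  1 <= \sum_(h in S) wt A S h.
Proof.
move: {2}#|A| (erefl #|A|) => k; elim: k A S h0 => [|k IHk] A S h0 cA h0S eqA.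
  rewrite (bigD1 h0) //= /wt (cards0_eq cA) (_ : [set _ in _ | _] = set0); last first.
    by apply/setP=> v; rewrite !inE.
  by rewrite cards0 expr0 lerDl sumr_ge0 // => h _; rewrite exprn_ge0 // invr_ge0.
have [v vA] : exists v, v \in A by apply/card_gt0P; rewrite cA.
pose Sl u := [set h in S | h v == u].
(* A flip at [w != v] keeps the value at [v] and so stays inside the slice; only a flip at [v]
   itself can cost a further factor 1/2. *)
have sub u h : h \in Sl u -> wt (A :\ v) (Sl u) h * (if flippable S h v then 2^-1 else 1) <= wt A S h.
  rewrite inE => /andP[hS /eqP hv]; rewrite /wt.
  have -> : (if flippable S h v then 2^-1 else 1) = 2^-1 ^+ flippable S h v :> R by case: ifP.
  rewrite -exprD ler_wiXn2l ?invr_ge0 ?invf_le1 ?ler1n //.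
  rewrite (cardsD1 v) inE vA /= addnC leq_add2r.
  apply/subset_leq_card/subsetP => w; rewrite !inE => /and3P[wv wA /flippableP[h' [h'S h'w eq]]].
  rewrite wv wA; apply/flippableP; exists h'; split=> //.
  by rewrite inE h'S (eq v) ?hv ?eqxx // eq_sym.
have IH u h : h \in Sl u -> 1 <= \sum_(h' in Sl u) wt (A :\ v) (Sl u) h'.
  move=> hS; apply: IHk (hS) _; first by move: cA; rewrite (cardsD1 v) vA => -[].
  move=> h1 h2; rewrite !inE => /andP[h1S /eqP h1v] /andP[h2S /eqP h2v] w.
  rewrite !inE negb_and negbK => /predU1P[->|wA]; [by rewrite h1v h2v | exact: eqA].
rewrite (partition_big (fun h => h v) predT) //=.
have slice u : \sum_(h in S | h v == u) wt A S h = \sum_(h in Sl u) wt A S h.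
  by apply: eq_bigl => h; rewrite inE.
under eq_bigr => u _ do rewrite slice.
(* With two nonempty slices each still contributes 1/2; with a single one [v] is never flippable and
   nothing is lost. *)
have [/exists_inP[h1 h1S h1v]|/exists_inPn none] := boolP [exists h in S, h v != h0 v].
  have half u h : h \in Sl u -> 2^-1 <= \sum_(h' in Sl u) wt A S h'.
    move=> hS; apply: (@le_trans _ _ (\sum_(h' in Sl u) wt (A :\ v) (Sl u) h' * 2^-1)).
      by rewrite -mulr_suml ler_peMl ?invr_ge0 ?(IH u h).
    apply: ler_sum => h' /sub; apply: le_trans; apply: ler_wpM2l => //.
    by case: ifP => // _; rewrite invf_le1 ?ler1n.
  rewrite (bigD1 (h0 v)) //= (bigD1 (h1 v)) //= addrA.
  apply: (@le_trans _ _ (2^-1 + 2^-1 + 0)); first by rewrite addr0; lra.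
  apply: lerD; last by apply: sumr_ge0 => u _; apply: sumr_ge0 => h _; apply: wt_ge0.
  by apply: lerD; [apply: (half _ h0) | apply: (half _ h1)]; rewrite inE ?h0S ?h1S eqxx.
rewrite (bigD1 (h0 v)) //= -[1]addr0.
apply: lerD; last by apply: sumr_ge0 => u _; apply: sumr_ge0 => h _; apply: wt_ge0.
have h0Sl : h0 \in Sl (h0 v) by rewrite inE h0S /=.
apply: (le_trans (IH _ _ h0Sl)); apply: ler_sum => h hSl.
apply: le_trans (sub _ _ hSl); case: flippableP => [[h' [h'S h'v _]]|_]; last by rewrite mulr1.
have := none _ h'S; rewrite negbK => /eqP h'0.
by move: hSl h'v; rewrite inE h'0 => /andP[_ /eqP ->]; rewrite eqxx.
Qed.

Lemma sum_flippable_weight S h0 : h0 \in S ->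
  1 <= \sum_(h in S) 2^-1 ^+ #|[set v | flippable S h v]| :> R.
Proof.
move=> h0S; apply: le_trans (sum_flippable_weight_on (A := [set: T]) h0S _) _.
  by move=> h h' _ _ w; rewrite inE.
by apply: ler_sum => h _; rewrite /wt; under eq_finset => v do rewrite inE.
Qed.
End FlippableCoordinates.

(** * Labelled cubic graphs with a given profile *)

Local Open Scope nat_scope.

Lemma cycle_graph_edge n (x y : 'I_n) :
  ([set x; y] \in cycle_graph n) = (y == ordS x) || (x == ordS y).
Proof.
apply/imsetP/orP => [[i _ eq]|[/eqP->|/eqP->]]; last 2 first.
- by exists x.
- by exists y; rewrite // setUC.
have /set2P hx : x \in [set i; ordS i] by rewrite -eq set21.
have /set2P hy : y \in [set i; ordS i] by rewrite -eq set22.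
have /set2P hi : i \in [set x; y] by rewrite eq set21.
have /set2P hs : ordS i \in [set x; y] by rewrite eq set22.
case: hx hy hi hs => -> [->|->]; rewrite ?eqxx; auto.
- by move=> _ [] e; rewrite e eqxx; left.
- by move=> [] e _; rewrite -!e eqxx; left.
Qed.

(** The colours before and after a given one differ. Hence the direction of a half-edge is
    unambiguous, and a shift by two is a genuine recolouring. *)
Lemma ordSS_neq (i : 'I_7) : i != ordS (ordS i).
Proof. by apply/eqP => /(congr1 val) /=; have := ltn_ord i; lia. Qed.

Section Labelings.
Variable T : finType.
Implicit Types (phi : {ffun T -> {ffun 'I_3 -> T}}) (E : {set {set T}}).
Local Notation point := (T * 'I_3)%type.
Local Notation profile := {ffun T -> 'I_7 * {ffun 'I_3 -> bool}}.

(* [phi v k] is the end of the [k]-th half-edge at [v].  A profile records the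
   colour of every vertex and, for every half-edge, whether it leads to the next
   ([true]) or to the previous ([false]) colour. *)
Definition labelings E :=
  [set phi in family (fun v => [set f : {ffun 'I_3 -> T} in ffun_on (mem (nbrs E v)) | injectiveb f])].

Lemma card_labelings E : cubic E -> #|labelings E| = 6 ^ #|T|.
Proof.
move=> cE; rewrite cardsE card_family foldrE big_image /=.
rewrite (eq_bigr (fun=> 6)) ?prod_nat_const // => v _.
by rewrite card_inj_ffuns_on cubic_nbrs // card_ord.
Qed.

Definition label_ok phi :=
  [forall v, injectiveb (phi v) && [forall k, exists l, phi (phi v k) l == v]].

Lemma labelingsP E phi : cubic E -> phi \in labelings E ->
  label_ok phi /\ forall v w, (w \in nbrs E v) = [exists k, phi v k == w].
Proof.
move=> cE; rewrite inE => /familyP lab.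
have inj v : injective (phi v) by have := lab v; rewrite !inE => /andP[_ /injectiveP].
have on v k : phi v k \in nbrs E v by have := lab v; rewrite inE => /andP[/ffun_onP].
have nb v w : (w \in nbrs E v) = [exists k, phi v k == w].
  have eqi : phi v @: [set: 'I_3] = nbrs E v.
    apply/eqP; rewrite eqEcard card_imset // cubic_nbrs // cardsT card_ord leqnn andbT.
    by apply/subsetP => _ /imsetP[k _ ->].
  rewrite -eqi; apply/imsetP/existsP => [[k _ ->]|[k /eqP <-]]; by exists k.
split=> //; apply/forallP => v; apply/andP; split; first exact/injectiveP.
by apply/forallP => k; rewrite -nb nbrsC.
Qed.

Lemma labelings_inj E E' phi : cubic E -> cubic E' ->
  phi \in labelings E -> phi \in labelings E' -> E = E'.
Proof.
move=> cE cE' /(labelingsP cE)[_ nb] /(labelingsP cE')[_ nb'].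
have adj x y : ([set x; y] \in E) = ([set x; y] \in E').
  by have := nb x y; have := nb' x y; rewrite !inE => -> ->.
have [/simple_graphP s _] := andP cE; have [/simple_graphP s' _] := andP cE'.
apply/setP => e; apply/idP/idP => eE.
  by have /eqP/cards2P[x [y [_ exy]]] := s e eE; rewrite exy -adj -exy.
by have /eqP/cards2P[x [y [_ exy]]] := s' e eE; rewrite exy adj -exy.
Qed.

(** The other half of the edge through the half-edge [p]. Under [label_ok] a suitable [l] exists and
    is unique, so the default [ord0] is never returned. *)
Definition partner phi (p : point) : point :=
  (phi p.1 p.2, odflt ord0 [pick l | phi (phi p.1 p.2) l == p.1]).

Lemma partnerK phi : label_ok phi -> involutive (partner phi).
Proof.
move=> /forallP ok [v k]; rewrite /partner /=.
have inj w : injective (phi w) by have /andP[/injectiveP] := ok w.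
case: pickP => [l /eqP /= el|none]; last first.
  by have /andP[_ /forallP /(_ k) /existsP[l]] := ok v; rewrite none.
rewrite el; case: pickP => [k' /eqP /inj -> //|/(_ k)]; by rewrite eqxx.
Qed.

Lemma partner_back phi v k : label_ok phi ->
  phi (partner phi (v, k)).1 (partner phi (v, k)).2 = v.
Proof. by move=> ok; have := congr1 fst (partnerK ok (v, k)). Qed.

(** For a compatible labelling, [plus x i] and [minus x (ordS i)] are the two sides of the edges
    between the colours [i] and [i + 1], so [plus x i] has [e_i] elements. *)
Definition plus (x : profile) i : {set point} := [set p | ((x p.1).1 == i) && (x p.1).2 p.2].
Definition minus (x : profile) i : {set point} := [set p | ((x p.1).1 == i) && ~~ (x p.1).2 p.2].

Definition compatible (x : profile) phi := label_ok phi && [forall p : point,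
  if (x p.1).2 p.2 then (x (phi p.1 p.2)).1 == ordS (x p.1).1
  else (x p.1).1 == ordS (x (phi p.1 p.2)).1].

Section Compatible.
Variables (x : profile) (phi : {ffun T -> {ffun 'I_3 -> T}}).
Hypothesis cx : compatible x phi.
Let ok : label_ok phi := proj1 (andP cx).
Let col (p : point) : if (x p.1).2 p.2 then (x (phi p.1 p.2)).1 == ordS (x p.1).1
  else (x p.1).1 == ordS (x (phi p.1 p.2)).1.
Proof. by have /andP[_ /forallP] := cx. Qed.

Lemma partner_plus i p : p \in plus x i -> partner phi p \in minus x (ordS i).
Proof.
case: p => v k; rewrite !inE => /andP[/eqP vi D].
have := col (v, k); rewrite /= D vi => /eqP wi; rewrite wi eqxx /=.
apply/negP => D'; have := col (partner phi (v, k)); rewrite partner_back // D' vi wi.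
by rewrite (negPf (ordSS_neq i)).
Qed.

Lemma partner_minus i p : p \in minus x (ordS i) -> partner phi p \in plus x i.
Proof.
case: p => v k; rewrite !inE => /andP[/eqP vi D].
have := col (v, k); rewrite /= (negPf D) vi eq_sym (inj_eq (@ordS_inj _)) => /eqP wi; rewrite wi eqxx /=.
apply: contraT => D'; have := col (partner phi (v, k)); rewrite partner_back // (negPf D') vi wi.
by rewrite (negPf (ordSS_neq i)).
Qed.

Lemma compatible_balanced i : #|minus x (ordS i)| = #|plus x i|.
Proof.
have inj : injective (partner phi) by apply: inv_inj; apply: partnerK.
apply/eqP; rewrite eqn_leq; apply/andP; split.
  by apply: (card_le_inj_in (f := partner phi)) => [p q _ _|p]; [exact: inj | exact: partner_minus].
by apply: (card_le_inj_in (f := partner phi)) => [p q _ _|p]; [exact: inj | exact: partner_plus].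
Qed.
End Compatible.

(** The functions are the identity off [plus x i], so that their values there carry no freedom and
    only the injections on [plus x i] are counted. *)
Definition matchings (x : profile) i := [set g : {ffun point -> point} |
  [forall p, if p \in plus x i then g p \in minus x (ordS i) else g p == p] && dinjectiveb g (mem (plus x i))].

Lemma card_matchings x i : #|minus x (ordS i)| = #|plus x i| -> #|matchings x i| <= #|plus x i|`!.
Proof.
move=> bal; pose P := {p | p \in plus x i}.
pose F (g : {ffun point -> point}) : {ffun P -> point} := [ffun p => g (val p)].
have -> : #|plus x i|`! = #|[set f : {ffun P -> point} in ffun_on (mem (minus x (ordS i))) | injectiveb f]|.
  by rewrite card_inj_ffuns_on bal card_sig ffactnn.
apply: (card_le_inj_in (f := F)).
  move=> g g'; rewrite !inE => /andP[/forallP a _] /andP[/forallP a' _] eq.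
  apply/ffunP => p; have := a p; have := a' p; case: ifP => [pP _ _|_ /eqP -> /eqP -> //].
  by have := congr1 (fun f : {ffun P -> point} => f (exist _ p pP)) eq; rewrite !ffunE.
move=> g; rewrite !inE => /andP[/forallP a /dinjectiveP inj]; apply/andP; split.
  by apply/ffun_onP => p; rewrite ffunE; have := a (val p); rewrite (valP p).
apply/injectiveP => p q; rewrite !ffunE => /inj eq; apply: val_inj; apply: eq; exact: valP.
Qed.

(** A labelling can be read off from its [partner] map. This involution exchanges [plus x i] with
    [minus x (ordS i)], so it is determined by one matching for each of the seven colours. *)
Lemma card_compatible (x : profile) :
  #|[set phi | compatible x phi]| <=
  if [forall i, #|minus x (ordS i)| == #|plus x i|] then \prod_i #|plus x i|`! else 0.
Proof.
case: ifP => [/forallP bal|/negbT]; last first.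
  rewrite negb_forall => /existsP[i ni]; rewrite leqn0 cards_eq0; apply/eqP/setP => phi.
  by rewrite !inE; apply: contraNF ni => /compatible_balanced ->.
pose F phi : {ffun 'I_7 -> {ffun point -> point}} :=
  [ffun i => [ffun p => if p \in plus x i then partner phi p else p]].
apply: (@leq_trans #|family (fun i => mem (matchings x i))|); last first.
  rewrite card_family foldrE big_image /=; apply: leq_prod => i _.
  by apply: card_matchings; apply/eqP.
apply: (card_le_inj_in (f := F)).
  move=> phi phi'; rewrite !inE => c c' eq.
  have plusE p : (x p.1).2 p.2 -> partner phi p = partner phi' p.
    move=> D; have := congr1 (fun f : {ffun 'I_7 -> {ffun point -> point}} => f (x p.1).1 p) eq; rewrite !ffunE.
    by rewrite inE eqxx D.
  have ok := proj1 (andP c); have ok' := proj1 (andP c').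
  have allE p : partner phi p = partner phi' p.
    have [/plusE //|D] := boolP ((x p.1).2 p.2).
    (* A backward half-edge is the partner of a forward one, where the two maps are already known to
       agree. *)
    have : p \in minus x (ordS (ord_pred (x p.1).1)) by rewrite inE ord_predK eqxx.
    move/(partner_minus c); rewrite inE => /andP[_ /plusE].
    by rewrite (partnerK ok) => eqp; rewrite [in RHS]eqp (partnerK ok').
  apply/ffunP => v; apply/ffunP => k; by have := congr1 fst (allE (v, k)).
move=> phi; rewrite inE => c; apply/familyP => i; rewrite -[_ \in _]/(F phi i \in matchings x i) in_set.
apply/andP; split.
  apply/forallP => p; rewrite !ffunE; case pP: (p \in plus x i); [exact: partner_plus | exact: eqxx].
apply/dinjectiveP => p q pP qP; rewrite !ffunE pP qP.
by apply: inv_inj; apply: partnerK; case/andP: c.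
Qed.
End Labelings.

(** * The weighted first moment *)

Local Open Scope ring_scope.

Lemma ler_sum_inj_in (R : numDomainType) (I J : finType) (A : {pred I}) (B : {pred J})
    (f : I -> J) (F : J -> R) :
  {in A &, injective f} -> {in A, forall i, f i \in B} -> (forall j, 0 <= F j) ->
  \sum_(i in A) F (f i) <= \sum_(j in B) F j.
Proof.
move=> f_inj fAB F0; rewrite -big_imset //= [leRHS](bigID (mem (f @: A))) /=.
rewrite (eq_bigl (fun j => (j \in B) && (j \in f @: A))); last first.
  by move=> j; apply/idP/andP => [jA|[]//]; split=> //; case/imsetP: jA => i /fAB ? ->.
by rewrite lerDl sumr_ge0.
Qed.

Section FirstMoment.
Variables (R : realFieldType) (T : finType).
Implicit Types (E : {set {set T}}) (h : {ffun T -> 'I_7}) (phi : {ffun T -> {ffun 'I_3 -> T}}).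
Local Notation profile := {ffun T -> 'I_7 * {ffun 'I_3 -> bool}}.

Definition homs E := [set h | is_hom E (cycle_graph 7) h].

Definition const_dir (D : {ffun 'I_3 -> bool}) := [forall k, D k] || [forall k, ~~ D k].

Definition dir_weight (D : {ffun 'I_3 -> bool}) : R := if const_dir D then 2^-1 else 1.

Definition profile_of h phi : profile := [ffun v => (h v, [ffun k => h (phi v k) == ordS (h v)])].

Lemma homsP E h : reflect
  (forall v w, w \in nbrs E v -> h w = ordS (h v) \/ h v = ordS (h w)) (h \in homs E).
Proof.
rewrite inE; apply: (iffP forallP) => [hE v w|hE v]; last first.
  apply/forallP => w; apply/implyP => vwE; rewrite cycle_graph_edge.
  by apply/orP; case: (hE v w); rewrite ?inE // => ->; [left|right].
rewrite inE => vwE; have /forallP /(_ w) := hE v; rewrite vwE cycle_graph_edge.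
by case/orP=> /eqP; auto.
Qed.

Lemma recolour_flippable E h v c : cubic E -> h \in homs E -> c != h v ->
  (forall w, w \in nbrs E v -> h w = ordS c \/ c = ordS (h w)) -> flippable (homs E) h v.
Proof.
move=> cE /homsP hE cv hv; apply/flippableP.
exists [ffun w => if w == v then c else h w]; split; last 2 first.
- by rewrite ffunE eqxx.
- by move=> w /negPf wv; rewrite ffunE wv.
have nv : v \notin nbrs E v.
  by apply/negP=> /(nbrs_neq (proj1 (andP cE))); rewrite eqxx.
apply/homsP => x y; rewrite !ffunE.
have [->|xv] := eqVneq x v; have [->|yv] := eqVneq y v.
- by rewrite (negPf nv).
- exact: hv.
- by rewrite nbrsC => /hv[]; auto.
- exact: hE.
Qed.

(** If all neighbours of [v] have the next colour, [v] can move two colours ahead; if all have the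
    previous one, two colours back. *)
Lemma const_dir_flippable E h phi v : cubic E -> h \in homs E -> phi \in labelings E ->
  const_dir (profile_of h phi v).2 -> flippable (homs E) h v.
Proof.
move=> cE hE pE; have [_ nb] := labelingsP cE pE; rewrite ffunE /=.
case/orP=> /forallP const.
  apply: (@recolour_flippable _ _ _ (ordS (ordS (h v)))) => //; first by rewrite eq_sym ordSS_neq.
  move=> w; rewrite nb => /existsP[k /eqP <-].
  by have := const k; rewrite ffunE => /eqP ->; right.
apply: (@recolour_flippable _ _ _ (ord_pred (ord_pred (h v)))) => //.
  by have := ordSS_neq (ord_pred (ord_pred (h v))); rewrite !ord_predK.
move=> w wv; have := wv; rewrite nb => /existsP[k /eqP ek].
have := const k; rewrite ffunE ek; move/homsP: hE => /(_ v w wv)[->|->].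
  by rewrite eqxx.
by rewrite ordSK ord_predK; left.
Qed.

Lemma profile_of_compatible E h phi : cubic E -> h \in homs E -> phi \in labelings E ->
  compatible (profile_of h phi) phi.
Proof.
move=> cE /homsP hE pE; have [ok nb] := labelingsP cE pE.
rewrite /compatible ok; apply/forallP => -[v k]; rewrite !ffunE /=.
case: ifP => [/eqP ->|/eqP nS]; first by rewrite eqxx.
by case: (hE v (phi v k)) => [||->]; rewrite ?eqxx // nb; apply/existsP; exists k.
Qed.

Definition balanced (x : profile) := [forall i, #|minus x (ordS i)| == #|plus x i|].

(** Triples of a graph, a homomorphism and a labelling are summed with weight. Each cubic graph has
    [6 ^ #|T|] labellings, and the homomorphisms of a graph counted on the left have total weight at
    least 1. A triple can be recovered from its profile and its labelling, which leaves compatible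
    labellings to count. *)
Lemma first_moment :
  (#|[set E : {set {set T}} | cubic E] :&: [set E | homomorphic E (cycle_graph 7)]| * 6 ^ #|T|)%:R <=
  \sum_(x | balanced x) (\prod_v dir_weight (x v).2) * (\prod_i #|plus x i|`!)%:R :> R.
Proof.
pose wt (x : profile) : R := \prod_v dir_weight (x v).2.
have dw0 D : 0 <= dir_weight D by rewrite /dir_weight; case: ifP; rewrite ?invr_ge0.
have wt0 x : 0 <= wt x by apply: prodr_ge0.
pose A := [pred t : {set {set T}} * ({ffun T -> 'I_7} * {ffun T -> {ffun 'I_3 -> T}}) |
  cubic t.1 && ((t.2.1 \in homs t.1) && (t.2.2 \in labelings t.1))].
apply: (@le_trans _ _ (\sum_(t in A) wt (profile_of t.2.1 t.2.2))).
  rewrite -(pair_big_dep (fun E => cubic E)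
    (fun E (t : {ffun T -> 'I_7} * {ffun T -> {ffun 'I_3 -> T}}) => (t.1 \in homs E) && (t.2 \in labelings E))
    (fun _ t => wt (profile_of t.1 t.2))) /=.
  rewrite natrM -[X in X%:R * _]sum1_card natr_sum mulr_suml.
  rewrite [leRHS](bigID (fun E => homomorphic E (cycle_graph 7))) /= -[leLHS]addr0.
  apply: lerD; last by apply: sumr_ge0 => E _; apply: sumr_ge0.
  rewrite (eq_bigl (fun E => cubic E && homomorphic E (cycle_graph 7))); last by move=> E; rewrite !inE.
  apply: ler_sum => E /andP[cE /existsP[h0 h0E]].
  rewrite -(pair_big_dep (fun h => h \in homs E) (fun _ phi => phi \in labelings E)
    (fun h phi => wt (profile_of h phi))) /=.
  have h0E' : h0 \in homs E by rewrite inE.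
  apply: (@le_trans _ _ (\sum_(h in homs E) 2^-1 ^+ #|[set v | flippable (homs E) h v]| * (6 ^ #|T|)%:R)).
    by rewrite -mulr_suml mul1r ler_peMl ?ler0n // (sum_flippable_weight _ h0E').
  apply: ler_sum => h hE; rewrite -(card_labelings cE) mulr_natr -sumr_const.
  apply: ler_sum => phi pE; rewrite /wt.
  rewrite -sum1_card -prodrXr [leLHS]big_mkcond /=; apply: ler_prod => v _.
  rewrite /dir_weight inE; have [cD|_] := boolP (const_dir _).
    by rewrite (const_dir_flippable cE hE pE cD) expr1 invr_ge0 ler0n lexx.
  by case: ifP => _; rewrite ?expr1 ?invr_ge0 ?ler0n ?lexx ?ler01 ?invf_le1 ?ler1n.
pose B := [pred t : profile * {ffun T -> {ffun 'I_3 -> T}} | compatible t.1 t.2].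
pose F (t : {set {set T}} * ({ffun T -> 'I_7} * {ffun T -> {ffun 'I_3 -> T}})) := (profile_of t.2.1 t.2.2, t.2.2).
apply: (@le_trans _ _ (\sum_(t in B) wt t.1)).
  apply: (@ler_sum_inj_in _ _ _ A B F (fun t => wt t.1)) => //.
    move=> [E [h phi]] [E' [h' phi']] /and3P[/= cE hE pE] /and3P[/= cE' hE' pE'] [eqx eqp].
    rewrite -eqp in pE' *; rewrite (labelings_inj cE cE' pE pE').
    suff -> : h = h' by [].
    apply/ffunP => v; have := congr1 (fun x : profile => (x v).1) eqx.
    by rewrite !ffunE.
  by move=> [E [h phi]] /and3P[/= cE hE pE]; apply: profile_of_compatible cE hE pE.
rewrite -(pair_big_dep predT (@compatible T) (fun x _ => wt x)) /= [leRHS]big_mkcond /=.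
apply: ler_sum => x _; rewrite sumr_const.
have := card_compatible x; rewrite cardsE -/(balanced x).
case: ifP => _; last by rewrite leqn0 => /eqP ->; rewrite mulr0n.
by move=> le; rewrite -[leLHS]mulr_natr ler_wpM2l // ler_nat.
Qed.
End FirstMoment.

(** * The generating function of the profiles *)

Section GeneratingFunction.
Variables (R : realFieldType) (T : finType).
Local Notation profile := {ffun T -> 'I_7 * {ffun 'I_3 -> bool}}.
Local Notation dirs := {ffun 'I_3 -> bool}.

(** Only the two constant directions are halved. The sum [(x + y)^3 - (x^3 + y^3)/2] falls below
    [7/8 (x + y)^3] by [3/8 (x + y)(x - y)^2]. *)
Lemma sum_dir_weight (x y : R) : 0 <= x -> 0 <= y ->
  \sum_(D : dirs) dir_weight R D * \prod_k (if D k then x else y) <= 7 / 8 * (x + y) ^+ 3.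
Proof.
move=> x0 y0; pose pr (D : dirs) : R := \prod_k (if D k then x else y).
pose D1 : dirs := [ffun=> true]; pose D0 : dirs := [ffun=> false].
have D10 : D0 != D1 by apply/eqP => /ffunP /(_ ord0); rewrite !ffunE.
have all : \sum_D pr D = (x + y) ^+ 3.
  rewrite /pr -(bigA_distr_bigA (fun (_ : 'I_3) (b : bool) => if b then x else y)) /=.
  by rewrite big_bool prodr_const card_ord.
have pr1 : pr D1 = x ^+ 3.
  by rewrite /pr; under eq_bigr => k _ do rewrite ffunE; rewrite prodr_const card_ord.
have pr0 : pr D0 = y ^+ 3.
  by rewrite /pr; under eq_bigr => k _ do rewrite ffunE; rewrite prodr_const card_ord.
have c1 : const_dir D1 by apply/orP; left; apply/forallP => k; rewrite ffunE.
have c0 : const_dir D0 by apply/orP; right; apply/forallP => k; rewrite ffunE.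
rewrite -/(pr _) (eq_bigr (fun D => dir_weight R D * pr D)) //.
move: all; rewrite (bigD1 D1) //= (bigD1 D0) //= pr1 pr0 => all.
rewrite (bigD1 D1) //= (bigD1 D0) //= pr1 pr0 /dir_weight c1 c0.
rewrite (eq_bigr pr); last first.
  move=> D /andP[n1 n0]; case: ifP => [/orP[]/forallP a|_]; last by rewrite mul1r.
    by case/eqP: n1; apply/ffunP => k; rewrite ffunE a.
  by case/eqP: n0; apply/ffunP => k; rewrite ffunE; exact: negbTE (a k).
move: all; set r := \sum_(_ | _) _ => all.
have -> : r = (x + y) ^+ 3 - x ^+ 3 - y ^+ 3 by rewrite -all; ring.
have -> : 2^-1 * x ^+ 3 + (2^-1 * y ^+ 3 + ((x + y) ^+ 3 - x ^+ 3 - y ^+ 3)) =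
  7 / 8 * (x + y) ^+ 3 - 3 / 8 * ((x + y) * (x - y) ^+ 2) by field.
rewrite gerBl; apply: mulr_ge0; first lra.
by apply: mulr_ge0; [exact: addr_ge0 | exact: sqr_ge0].
Qed.

Lemma prod_profile (c : profile) (x y : 'I_7 -> R) : balanced c ->
  \prod_v \prod_k (if (c v).2 k then x (c v).1 else y (c v).1) =
  \prod_i (x i * y (ordS i)) ^+ #|plus c i|.
Proof.
move=> /forallP bal; rewrite pair_big /= (bigID (fun p : T * 'I_3 => (c p.1).2 p.2)) /=.
under [RHS]eq_bigr => i _ do rewrite exprMn.
rewrite big_split /=; congr (_ * _).
  rewrite (partition_big (fun p : T * 'I_3 => (c p.1).1) predT) //=; apply: eq_bigr => i _.
  rewrite -prodr_const; apply: eq_big => [p|p]; first by rewrite !inE andbC.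
  by case/andP=> -> /eqP ->.
rewrite (partition_big (fun p : T * 'I_3 => (c p.1).1) predT) //= (reindex_inj (@ordS_inj 7)) /=.
apply: eq_bigr => i _; rewrite -(eqP (bal i)) -prodr_const.
apply: eq_big => [p|p]; first by rewrite !inE andbC.
by case/andP=> /negPf -> /eqP ->.
Qed.

(** One term of a generating function with nonnegative terms is at most its value, and the sum over
    all profiles factors over the vertices. *)
Lemma sum_profiles (x y : 'I_7 -> R) (e : 'I_7 -> nat) :
  (forall i, 0 <= x i) -> (forall i, 0 <= y i) ->
  \sum_(c : profile | balanced c && [forall i, #|plus c i| == e i])
     (\prod_v dir_weight R (c v).2) * \prod_i (x i * y (ordS i)) ^+ e i
  <= (7 / 8 * \sum_i (x i + y i) ^+ 3) ^+ #|T|.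
Proof.
move=> x0 y0; have dw0 D : 0 <= dir_weight R D by rewrite /dir_weight; case: ifP; rewrite ?invr_ge0.
pose G (p : 'I_7 * dirs) := dir_weight R p.2 * \prod_k (if p.2 k then x p.1 else y p.1).
have G0 p : 0 <= G p by rewrite mulr_ge0 // prodr_ge0 // => k _; case: ifP.
apply: (@le_trans _ _ (\sum_(c : profile) \prod_v G (c v))).
  rewrite [leRHS](bigID (fun c => balanced c && [forall i, #|plus c i| == e i])) /= -[leLHS]addr0.
  apply: lerD; last by apply: sumr_ge0 => c _; apply: prodr_ge0.
  apply: ler_sum => c /andP[bal /forallP ce]; rewrite /G big_split /= ler_wpM2l ?prodr_ge0 //.
  by rewrite prod_profile //; under [leRHS]eq_bigr => i _ do rewrite (eqP (ce i)).
rewrite -(bigA_distr_bigA (fun (_ : T) p => G p)) /= prodr_const.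
have le : \sum_p G p <= 7 / 8 * \sum_i (x i + y i) ^+ 3.
  rewrite -(pair_bigA _ (fun c D => G (c, D))) /= mulr_sumr.
  by apply: ler_sum => c _; apply: le_trans (sum_dir_weight (x0 c) (y0 c)).
have s0 : 0 <= \sum_p G p by apply: sumr_ge0.
by apply: lerXn2r; rewrite ?nnegrE // (le_trans s0).
Qed.

Lemma balanced_total (c : profile) : balanced c -> (2 * \sum_i #|plus c i| = 3 * #|T|)%N.
Proof.
move=> /forallP bal.
have -> : (3 * #|T| = \sum_i #|plus c i| + \sum_i #|minus c i|)%N.
  have -> : (3 * #|T| = #|{: T * 'I_3}|)%N by rewrite card_prod card_ord mulnC.
  rewrite -sum1_card (partition_big (fun p : T * 'I_3 => (c p.1).1) predT) //= -big_split /=.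
  apply: eq_bigr => i _; rewrite (bigID (fun p : T * 'I_3 => (c p.1).2 p.2)) /= !sum1_card.
  by congr addn; apply: eq_card => p; rewrite !inE.
rewrite [X in (_ + X)%N](reindex_inj (@ordS_inj 7)) /=.
by under [X in (_ + X)%N]eq_bigr => i _ do rewrite (eqP (bal i)); rewrite mul2n addnn.
Qed.

(** Profiles are grouped by the seven counts [e i], each at most [3 * #|T|]. As in the saddle point
    method, [x] and [y] may be chosen separately for each group. *)
Lemma sum_balanced_le (B : R) : 0 <= B ->
  (forall e : 'I_7 -> nat, (2 * \sum_i e i = 3 * #|T|)%N ->
   exists x y : 'I_7 -> R,
     [/\ forall i, 0 <= x i, forall i, 0 <= y i, 0 < \prod_i (x i * y (ordS i)) ^+ e i &
      (7 / 8 * \sum_i (x i + y i) ^+ 3) ^+ #|T| * (\prod_i (e i)`!)%:R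
        <= B * \prod_i (x i * y (ordS i)) ^+ e i]) ->
  \sum_(c : profile | balanced c) (\prod_v dir_weight R (c v).2) * (\prod_i #|plus c i|`!)%:R
    <= ((3 * #|T|).+1 ^ 7)%:R * B.
Proof.
move=> B0 H; pose K := (3 * #|T|)%N.
pose cnt (c : profile) : {ffun 'I_7 -> 'I_K.+1} := [ffun i => inord #|plus c i|].
have cntE c i : cnt c i = #|plus c i| :> nat.
  rewrite ffunE inordK // ltnS /K.
  have -> : (3 * #|T| = #|{: T * 'I_3}|)%N by rewrite card_prod card_ord mulnC.
  exact: max_card.
rewrite (partition_big cnt predT) //=.
have -> : ((3 * #|T|).+1 ^ 7)%:R * B = \sum_(e : {ffun 'I_7 -> 'I_K.+1}) B.
  by rewrite sumr_const card_ffun !card_ord mulr_natl.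
apply: ler_sum => e _; pose P c := balanced c && (cnt c == e).
have PE c : P c = balanced c && [forall i, #|plus c i| == e i].
  congr (_ && _); apply/eqP/forallP => [<- i|eq]; first by rewrite cntE.
  by apply/ffunP => i; apply/val_inj; rewrite /= cntE (eqP (eq i)).
have [c0 Pc0|none] := pickP P; last by rewrite big_pred0.
have [bal0 /forallP e0] : balanced c0 /\ [forall i, #|plus c0 i| == e i].
  by apply/andP; rewrite -PE.
have tot : (2 * \sum_i e i = 3 * #|T|)%N.
  by rewrite -(balanced_total bal0); congr muln; apply: eq_bigr => i _; rewrite (eqP (e0 i)).
have [x [y [x0 y0 pos le]]] := H (fun i => e i) tot.
rewrite -(ler_pM2r pos); apply: le_trans le; rewrite mulr_suml.
apply: le_trans (ler_wpM2r (ler0n _ _) (sum_profiles (fun i => e i) x0 y0)).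
rewrite mulr_suml (eq_bigl _ _ PE); apply: ler_sum => c /andP[_ /forallP ce].
rewrite (_ : \prod_i #|plus c i|`! = \prod_i (e i)`!)%N; last first.
  by apply: eq_bigr => i _; rewrite (eqP (ce i)).
by rewrite -!mulrA [X in _ * X]mulrC.
Qed.
End GeneratingFunction.

(** * Solutions of the critical equations *)

Section BranchAndBound.
Local Open Scope N_scope.

(* Coordinates are measured in units of [1 / scale].  [M] is the largest
   coordinate, [a <= b] are its neighbours, [c], [e] follow [a] and [d], [g]
   follow [b]; all are bounded from below by rounding down, and a negative
   radicand is truncated to [0]. *)
Definition scale : N := 1000.

Definition cell_ok (M1 M2 a1 a2 : N) : bool :=
  (* The first three tests discard cells without solutions: [a <= b] and [a^2 + b^2 = M] give
     [2 a^2 <= M], [b <= M] gives [M <= a^2 + M^2], and [M^2 + c^2 = a] gives [M^2 <= a]. *)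
  if scale * M2 <? 2 * (a1 * a1) then true
  else if a2 * a2 + M2 * M2 <? scale * M1 then true
  else if scale * a2 <? M1 * M1 then true
  else
    let b := N.sqrt (N.max (scale * M1 - a2 * a2) (N.div2 (scale * M1))) in
    let c := N.sqrt (scale * a1 - M2 * M2) in
    let d := N.sqrt (scale * b - M2 * M2) in
    let e := N.sqrt (scale * c - a2 * a2) in
    (* Here [b^2] is subtracted, so it is bounded from above, by [M - a^2] and by [M^2]. *)
    let g := N.sqrt (scale * d - N.min (scale * M2 - a1 * a1) (M2 * M2)) in
    766 * (scale * scale * scale) <=?
    1000 * (M1 * M1 * M1 + a1 * a1 * a1 + b * b * b + c * c * c + d * d * d + e * e * e + g * g * g).

(** Bisection of the longer side of the rectangle; running out of [fuel] counts as failure. *)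
Fixpoint cover (fuel : nat) (M1 M2 a1 a2 : N) : bool :=
  if cell_ok M1 M2 a1 a2 then true else
  if fuel is fuel'.+1 then
    if a2 - a1 <=? M2 - M1 then
      let m := N.div2 (M1 + M2) in
      if cover fuel' M1 m a1 a2 then cover fuel' m M2 a1 a2 else false
    else
      let m := N.div2 (a1 + a2) in
      if cover fuel' M1 M2 a1 m then cover fuel' M1 M2 m a2 else false
  else false.

(** The rectangle [1/2 <= M <= 4/5], [1/4 <= a <= 13/20] contains the pair [(M, a)] of every
    solution, as shown in [critical_cubes]. *)
Lemma cover_root : cover 20 500 800 250 650.
Proof. by vm_compute. Qed.
End BranchAndBound.

Definition N_inj (R : realFieldType) (n : N) : R := (N.to_nat n)%:R%R.

(** * Soundness of the subdivision over a real field *)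

Section CoverSound.
Variable R : realFieldType.
Local Open Scope ring_scope.
Local Notation "n %:r" := (N_inj R n) (at level 2, left associativity, format "n %:r").

Let n0 n : 0 <= n%:r.
Proof. exact: ler0n. Qed.

Let nD m n : (m + n)%num%:r = m%:r + n%:r.
Proof. by rewrite /N_inj N2Nat.inj_add -natrD. Qed.

Let nM m n : (m * n)%num%:r = m%:r * n%:r.
Proof. by rewrite /N_inj N2Nat.inj_mul -natrM. Qed.

Let n_le m n : (m <=? n)%num -> m%:r <= n%:r.
Proof. by move=> mn; rewrite /N_inj ler_nat; lia. Qed.

Let n_lt m n : (m <? n)%num -> m%:r < n%:r.
Proof. by move=> mn; rewrite /N_inj ltr_nat; lia. Qed.

Let nB (z : R) m n : 0 <= z -> m%:r - n%:r <= z -> (m - n)%num%:r <= z.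
Proof.
move=> z0; have [nm|mn] := leP n%:r m%:r.
  by move: nm; rewrite /N_inj ler_nat => nm; rewrite -natrB // N2Nat.inj_sub.
move: mn; rewrite /N_inj ltr_nat => mn _; suff -> : (m - n)%num = 0%num by [].
by lia.
Qed.

Let nsqrt (z : R) n : 0 <= z -> n%:r <= z * z -> (N.sqrt n)%:r <= z.
Proof.
move=> z0 le; rewrite -ler_sqr ?nnegrE ?n0 // !expr2.
apply: le_trans le; rewrite -nM; apply: n_le; apply/N.leb_le.
by have [] := N.sqrt_spec n (N.le_0_l n).
Qed.

Let nmax (z : R) m n : m%:r <= z -> n%:r <= z -> (N.max m n)%:r <= z.
Proof. by case: (N.max_spec m n) => -[_ ->]. Qed.

Let cube (m : N) (z : R) : 0 <= z -> m%:r <= z -> (m * m * m)%num%:r <= z ^+ 3.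
Proof.
move=> z0 mz; rewrite !nM (_ : _ * _ * _ = m%:r ^+ 3); last by rewrite !exprS expr0 mulr1 mulrA.
by apply: lerXn2r; rewrite ?nnegrE.
Qed.

Let sq (m : N) (z : R) : m%:r <= z -> m%:r * m%:r <= z * z.
Proof. by move=> mz; apply: ler_pM. Qed.

Let sq' (m : N) (z : R) : 0 <= z -> z <= m%:r -> z * z <= m%:r * m%:r.
Proof. by move=> z0 zm; apply: ler_pM. Qed.

Let nhalf n : (N.div2 n)%:r + (N.div2 n)%:r <= n%:r.
Proof. by rewrite -nD; apply: n_le; have := N.div2_odd n; lia. Qed.

Section Sound.
Local Notation s := (N_inj R scale).
Variables M a b c d e g : R.

Let goal := 766%num%:r * (s * s * s) <=
  1000%num%:r * (M ^+ 3 + a ^+ 3 + b ^+ 3 + c ^+ 3 + d ^+ 3 + e ^+ 3 + g ^+ 3).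

Let hyps := [/\ [/\ 0 <= M, 0 <= a & 0 <= b], [/\ 0 <= c, 0 <= d, 0 <= e & 0 <= g], a <= b <= M,
  [/\ a * a + b * b = s * M, M * M + c * c = s * a & M * M + d * d = s * b] &
  a * a + e * e = s * c /\ b * b + g * g = s * d].

(** Lower bounds are propagated in the order [b], [c], [d], [e], [g]: each equation bounds the next
    square by a known lower bound minus the square of a known upper bound. *)
Lemma cell_sound M1 M2 a1 a2 : hyps -> cell_ok M1 M2 a1 a2 ->
  M1%:r <= M <= M2%:r -> a1%:r <= a <= a2%:r -> goal.
Proof.
case=> -[M0 a0 b0] [c0 d0 e0 g0] /andP[ab bM] [EM Ea Eb] [Ec Ed].
move=> + /andP[M1M MM2] /andP[a1a aa2].
have aM1 := sq M1M; have aM2 := sq' M0 MM2; have aa1 := sq a1a; have aa2' := sq' a0 aa2.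
have aab : a * a <= b * b by apply: ler_pM.
have bbM : b * b <= M * M by apply: ler_pM.
have cc0 : 0 <= c * c by apply: mulr_ge0.
have mono x y : x <= y -> s * x <= s * y by move=> xy; apply: ler_wpM2l.
have sM1 := mono _ _ M1M; have sM2 := mono _ _ MM2.
have sa1 := mono _ _ a1a; have sa2 := mono _ _ aa2.
rewrite /cell_ok; case: ifP => [/n_lt|_].
  by rewrite !nM -[2%num]/(1 + 1)%num nD (_ : 1%num%:r = 1) // => H; exfalso; lra.
case: ifP => [/n_lt|_]; first by rewrite nD !nM => H; exfalso; lra.
case: ifP => [/n_lt|_]; first by rewrite !nM => H; exfalso; lra.
set b1 := N.sqrt (N.max _ _); set c1 := N.sqrt _; set d1 := N.sqrt _.
set e1 := N.sqrt _; set g1 := N.sqrt _.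
have b1b : b1%:r <= b.
  apply: nsqrt => //; apply: nmax; last by have := nhalf (scale * M1); rewrite nM; lra.
  by apply: nB; [apply: mulr_ge0 | rewrite !nM; lra].
have sb1 := mono _ _ b1b.
have c1c : c1%:r <= c.
  by apply: nsqrt => //; apply: nB; [apply: mulr_ge0 | rewrite !nM; lra].
have sc1 := mono _ _ c1c.
have d1d : d1%:r <= d.
  by apply: nsqrt => //; apply: nB; [apply: mulr_ge0 | rewrite !nM; lra].
have sd1 := mono _ _ d1d.
have e1e : e1%:r <= e.
  by apply: nsqrt => //; apply: nB; [apply: mulr_ge0 | rewrite !nM; lra].
have bb2 : b * b <= (N.min (scale * M2 - a1 * a1) (M2 * M2))%:r.
  case: (N.min_spec (scale * M2 - a1 * a1) (M2 * M2)) => -[_ ->]; last by rewrite nM; lra.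
  have bl : b * b <= (scale * M2)%num%:r - (a1 * a1)%num%:r by rewrite !nM; lra.
  apply: (le_trans bl); rewrite /N_inj N2Nat.inj_sub natrB //.
  have : (a1 * a1)%num%:r <= (scale * M2)%num%:r by have := mulr_ge0 b0 b0; lra.
  by rewrite /N_inj ler_nat.
have g1g : g1%:r <= g.
  by apply: nsqrt => //; apply: nB; [apply: mulr_ge0 | rewrite nM; lra].
move=> /n_le; rewrite (nM 766%num) (nM (scale * scale)) (nM scale) (nM 1000%num) !nD.
move=> H; apply: (le_trans H); apply: ler_wpM2l => //.
by do 6?[apply: lerD]; apply: cube.
Qed.

Lemma cover_sound fuel M1 M2 a1 a2 : hyps -> cover fuel M1 M2 a1 a2 ->
  M1%:r <= M <= M2%:r -> a1%:r <= a <= a2%:r -> goal.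
Proof.
move=> hyp; elim: fuel M1 M2 a1 a2 => [|fuel IH] M1 M2 a1 a2 /=;
  case: ifP => [/(cell_sound hyp) ok _|_] //; try exact: ok.
case: ifP => _; case: ifP => // cov1 cov2.
  move=> /andP[M1M MM2] aa; have [Mm|mM] := leP M (N.div2 (M1 + M2))%:r.
    by apply: IH cov1 _ aa; rewrite M1M.
  by apply: IH cov2 _ aa; rewrite MM2 ltW.
move=> MM /andP[a1a aa2]; have [am|ma] := leP a (N.div2 (a1 + a2))%:r.
  by apply: IH cov1 MM _; rewrite a1a.
by apply: IH cov2 MM _; rewrite aa2 ltW.
Qed.
End Sound.
End CoverSound.

Lemma critical_cubes (R : realFieldType) (M a b c d e g : R) :
  0 < M -> [/\ 0 <= a, 0 <= b & 0 <= c] -> [/\ 0 <= d, 0 <= e & 0 <= g] ->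
  a <= b -> b <= M -> a ^+ 2 + b ^+ 2 = M ->
  M ^+ 2 + c ^+ 2 = a -> M ^+ 2 + d ^+ 2 = b -> a ^+ 2 + e ^+ 2 = c -> b ^+ 2 + g ^+ 2 = d ->
  766 / 1000 <= M ^+ 3 + a ^+ 3 + b ^+ 3 + c ^+ 3 + d ^+ 3 + e ^+ 3 + g ^+ 3.
Proof.
move=> M0 [a0 b0 c0] [d0 e0 g0] ab bM EM Ea Eb Ec Ed.
have aa : a ^+ 2 <= b ^+ 2 by rewrite ler_sqr ?nnegrE.
have bb : b ^+ 2 <= M ^+ 2 by rewrite ler_sqr ?nnegrE // ltW.
(* From [M = a^2 + b^2 <= 2 M^2]. *)
have M_ge : 1 / 2 <= M.
  rewrite leNgt; apply/negP => lt.
  have : M * M < M * (1 / 2) by rewrite ltr_pM2l.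
  by rewrite -expr2; lra.
have MMa : M ^+ 2 <= a by rewrite -Ea lerDl sqr_ge0.
have MM0 : 0 <= M ^+ 2 by rewrite sqr_ge0.
(* From [M >= 2 a^2 >= 2 M^4] and [2 (8/10)^3 > 1]. *)
have M_le : M <= 8 / 10.
  rewrite leNgt; apply/negP => M8.
  have MM : (8 / 10) ^+ 2 < M ^+ 2 by rewrite ltr_sqr ?nnegrE; lra.
  have M3 : (8 / 10) ^+ 2 * M <= M ^+ 2 * M by rewrite ler_pM2r // ltW.
  have aa2 : M ^+ 2 * M ^+ 2 <= a ^+ 2 by rewrite [leRHS]expr2; apply: ler_pM.
  have : (8 / 10) * (M ^+ 2 * M) < M * (M ^+ 2 * M) by rewrite ltr_pM2r // mulr_gt0 // exprn_gt0.
  have -> : M * (M ^+ 2 * M) = M ^+ 2 * M ^+ 2 by ring.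
  lra.
have a_ge : 1 / 4 <= a.
  apply: le_trans MMa; rewrite (_ : 1 / 4 = (1 / 2) ^+ 2); last by field.
  by rewrite ler_sqr ?nnegrE; lra.
have a_le : a <= 65 / 100.
  rewrite leNgt; apply/negP => a8.
  have : (65 / 100) ^+ 2 < a ^+ 2 by rewrite ltr_sqr ?nnegrE; lra.
  lra.
pose s : R := N_inj R scale.
have sE : s = 1000 by [].
have s0 : 0 <= s by rewrite sE; lra.
have scaled2 x y z : x ^+ 2 + y ^+ 2 = z -> s * x * (s * x) + s * y * (s * y) = s * (s * z).
  by move=> <-; ring.
have : 766 * (s * s * s) <= 1000 * ((s * M) ^+ 3 + (s * a) ^+ 3 + (s * b) ^+ 3 +
  (s * c) ^+ 3 + (s * d) ^+ 3 + (s * e) ^+ 3 + (s * g) ^+ 3).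
  apply: cover_sound cover_root _ _.
  - by split; [split | split | | split | split]; rewrite ?mulr_ge0 ?(ltW M0) ?ler_wpM2l //; exact: scaled2.
  - by rewrite -[N_inj R 500]/(500%:R) -[N_inj R 800]/(800%:R) sE; lra.
  - by rewrite -[N_inj R 250]/(250%:R) -[N_inj R 650]/(650%:R) sE; lra.
have s3 : 0 < s ^+ 3 by rewrite exprn_gt0 // sE; lra.
rewrite !exprMn -!mulrDr => H; rewrite -(ler_pM2l s3).
have : s * s * s = s ^+ 3 by ring.
move=> E; rewrite E in H.
move: H; move: (s ^+ 3) => t H; lra.
Qed.

(** * Maximising the quartic form *)

From mathcomp Require Import all_classical all_reals all_analysis.
Import numFieldNormedType.Exports.
Local Open Scope classical_set_scope.
Local Open Scope ring_scope.

(** A linear term dominated by a quadratic one on both sides of 0 must vanish. This takes the place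
    of a derivative at a maximum. *)
Lemma first_order_zero (R : realFieldType) (A K r : R) : 0 < r ->
  (forall d, `|d| <= r -> d * A <= K * d ^+ 2) -> A = 0.
Proof.
move=> r0 H.
have pos (B : R) : (forall d, 0 < d -> d <= r -> d * B <= K * d ^+ 2) -> B <= 0.
  move=> HB; rewrite leNgt; apply/negP => B0.
  pose d := Num.min r (B / (`|K| + 1) / 2).
  have K1 : 0 < `|K| + 1 by rewrite ltr_wpDl.
  have d0 : 0 < d by rewrite lt_min r0 !divr_gt0.
  have /HB := d0; rewrite ge_min lexx => /(_ isT).
  rewrite expr2 mulrCA ler_pM2l // leNgt => /negP[].
  have dB : d * (`|K| + 1) <= B / 2.
    rewrite -ler_pdivlMr // (le_trans (_ : _ <= B / (`|K| + 1) / 2)) ?ge_min ?lexx ?orbT //.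
    by rewrite mulrAC.
  have : K * d <= d * (`|K| + 1).
    rewrite [leRHS]mulrC ler_pM2r // (le_trans (ler_norm K)) // lerDl //.
  by move=> Kd; apply: (le_lt_trans Kd); apply: (le_lt_trans dB); rewrite ltr_pdivrMr //; lra.
apply/eqP; rewrite eq_le; apply/andP; split.
  by apply: pos => d d0 dr; apply: H; rewrite gtr0_norm.
rewrite -oppr_le0; apply: pos => d d0 dr.
have := H (- d); rewrite normrN gtr0_norm // => /(_ dr).
by rewrite sqrrN mulNr mulrN.
Qed.

Lemma cube_root (R : realType) (x : R) : 0 <= x -> exists2 y, 0 <= y & y ^+ 3 = x.
Proof.
move=> x0; exists (x `^ 3^-1); first exact: powR_ge0.
by rewrite -powR_mulrn ?powR_ge0 // -powRrM mulVf ?pnatr_eq0 // powRr1.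
Qed.

(** * The condition for a maximum in a single coordinate *)

Section CriticalEquation.
Variables (R : realFieldType) (G C r n t : R).
Hypotheses (G0 : 0 < G) (C0 : 0 <= C) (t0 : 0 <= t) (r0 : 0 <= r) (n0 : 0 <= n).
Hypotheses (EG : C * t ^+ 2 + r = G) (En : t ^+ 3 + n = 1).
Hypothesis H : forall x, 0 <= x -> (C * x ^+ 2 + r) ^+ 3 <= G ^+ 3 * (x ^+ 3 + n) ^+ 4.

(** Here [v] is the change of the sum of cubes and [u] that of the quartic form. To first order the
    hypothesis compares [3 u] with [4 G v]; the coefficient [11 = 6 + 4 + 1] absorbs the higher
    powers of [v]. *)
Let expansion x (v := x ^+ 3 - t ^+ 3) : 0 <= x -> `|v| <= 1 ->
  3 * C * (x ^+ 2 - t ^+ 2) <= G * (4 * v + 11 * v ^+ 2).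
Proof.
move=> x0 v1; pose u := C * (x ^+ 2 - t ^+ 2).
have uE : C * x ^+ 2 + r = G + u by rewrite -EG /u; ring.
have := H x0; rewrite uE (_ : x ^+ 3 + n = 1 + v); last by rewrite -En /v; ring.
have v4 : (1 + v) ^+ 4 <= 1 + (4 * v + 11 * v ^+ 2).
  have vv0 := sqr_ge0 v; have [vl vr] : -1 <= v /\ v <= 1 by apply/andP; rewrite -ler_norml.
  have : v ^+ 2 * v <= v ^+ 2 * 1 by rewrite ler_wpM2l.
  have : v ^+ 2 * v ^+ 2 <= v ^+ 2 * 1.
    by rewrite ler_wpM2l // -[leRHS](expr1n _ 2) -real_normK ?num_real // ler_sqr ?nnegrE.
  rewrite (_ : (1 + v) ^+ 4 = 1 + 4 * v + 6 * v ^+ 2 + 4 * (v ^+ 2 * v) + v ^+ 2 * v ^+ 2); last by ring.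
  lra.
have u3 : G ^+ 3 + 3 * G ^+ 2 * u <= (G + u) ^+ 3.
  rewrite (_ : (G + u) ^+ 3 = G ^+ 3 + 3 * G ^+ 2 * u + u ^+ 2 * (3 * G + u)); last by ring.
  rewrite lerDl mulr_ge0 ?sqr_ge0 //.
  have : 0 <= G + u by rewrite -uE addr_ge0 // mulr_ge0 // sqr_ge0.
  by have := G0; lra.
move=> le; have {}le := le_trans u3 le.
have G3 : 0 <= G ^+ 3 by rewrite exprn_ge0 // ltW.
have {}le := le_trans le (ler_wpM2l G3 v4).
rewrite -(ler_pM2l (exprn_gt0 2 G0)) -/u.
rewrite (_ : G ^+ 2 * (G * (4 * v + 11 * v ^+ 2)) = G ^+ 3 * (1 + (4 * v + 11 * v ^+ 2)) - G ^+ 3); last by ring.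
rewrite (_ : G ^+ 2 * (3 * C * (x ^+ 2 - t ^+ 2)) = G ^+ 3 + 3 * G ^+ 2 * u - G ^+ 3); last by rewrite /u; ring.
by rewrite lerB.
Qed.
(** For [x = t + d] the linear coefficients in [d] on the two sides of [expansion] are [6 C t] and
    [12 G t^2], which have to agree. *)
Lemma critical_equation : C = 2 * G * t.
Proof.
have G_gt0 := G0; have C_ge0 := C0; have t_ge0 := t0.
have t1 : t <= 1.
  rewrite -(ler_pXn2r (isT : (0 < 3)%N)) ?nnegrE // expr1n -En.
  by have := n0; lra.
(* At [t = 0] only one side is available, but there [C x^2] is bounded by a multiple of [x^3], which
   rules out [C > 0] for small [x]. *)
have [tz|tp] := eqVneq t 0.
  rewrite tz mulr0; apply/eqP; rewrite eq_le C0 andbT leNgt; apply/negP => Cp.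
  pose x := Num.min 1 (C / (10 * G)).
  have xp : 0 < x by rewrite lt_min ltr01 divr_gt0 // mulr_gt0.
  have x1 : x <= 1 by rewrite ge_min lexx.
  have xC : x * (10 * G) <= C by rewrite -ler_pdivlMr ?mulr_gt0 // ge_min lexx orbT.
  have x3p : 0 < x ^+ 3 by rewrite exprn_gt0.
  have x31 : x ^+ 3 <= 1 by rewrite exprn_ile1 // ltW.
  have := @expansion x (ltW xp); rewrite tz !expr0n /= !subr0 gtr0_norm // => /(_ x31) le.
  have le2 : x ^+ 3 ^+ 2 <= x ^+ 3 by rewrite expr2 ler_piMr // ltW.
  have : 3 * C * x ^+ 2 <= 15 * (G * x) * x ^+ 2.
    apply: (le_trans le); rewrite (_ : 15 * _ * _ = G * (4 * x ^+ 3 + 11 * x ^+ 3)); last by ring.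
    by rewrite ler_pM2l // lerD2l ler_pM2l.
  rewrite ler_pM2r ?exprn_gt0 //; lra.
have {}tp : 0 < t by rewrite lt_neqAle eq_sym tp.
suff : 6 * C * t - 12 * G * t ^+ 2 = 0.
  move=> E; have : 6 * t * (C - 2 * G * t) = 0 by rewrite -E; ring.
  move/eqP; rewrite !mulf_eq0 pnatr_eq0 /= gt_eqF //= => /eqP; lra.
(* The bound [t] keeps [t + d] nonnegative; the bound [1/7] keeps the change [d * w] of the cube
   within 1, as [w] is at most 7 in absolute value. *)
pose rho := Num.min t (1 / 7).
(* [543 = 4 + 11 * 49] comes from [d^3 <= d^2] and [w^2 <= 49]. *)
apply: (@first_order_zero _ _ (G * (12 * t + 543)) rho); first by rewrite lt_min tp; lra.
move=> d; rewrite le_min => /andP[dt d7].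
have [dl dr] : - t <= d /\ d <= t by apply/andP; rewrite -ler_norml.
have [el er] : - (1 / 7) <= d /\ d <= 1 / 7 by apply/andP; rewrite -ler_norml.
have x0 : 0 <= t + d by lra.
pose w := 3 * t ^+ 2 + 3 * t * d + d ^+ 2.
have tt : t ^+ 2 <= 1 by rewrite exprn_ile1.
have dd0 := sqr_ge0 d.
have dd : d ^+ 2 <= 1.
  rewrite -real_normK ?num_real // exprn_ile1 //; lra.
have td : `|t * d| <= 1 by rewrite normrM ger0_norm // mulr_ile1 //; lra.
have [tdl tdr] : -1 <= t * d /\ t * d <= 1 by apply/andP; rewrite -ler_norml.
have tt0 := sqr_ge0 t.
have w7 : `|w| <= 7 by rewrite ler_norml /w; apply/andP; split; lra.
have vE : (t + d) ^+ 3 - t ^+ 3 = d * w by rewrite /w; ring.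
have v1 : `|(t + d) ^+ 3 - t ^+ 3| <= 1.
  rewrite vE normrM (_ : 1 = 1 / 7 * 7); last by field.
  by apply: ler_pM.
have := expansion x0 v1; rewrite vE.
have w49 : w ^+ 2 <= 49.
  rewrite (_ : 49 = 7 ^+ 2); last by ring.
  by rewrite -real_normK ?num_real // ler_sqr ?nnegrE //; lra.
have ww : d ^+ 2 * w ^+ 2 <= d ^+ 2 * 49 by rewrite ler_wpM2l.
have d3 : d ^+ 2 * d <= d ^+ 2 * 1 by rewrite ler_wpM2l //; lra.
have Cd : 0 <= C * d ^+ 2 by rewrite mulr_ge0.
move=> le; have le2 : 4 * (d * w) + 11 * (d * w) ^+ 2 <= 12 * t ^+ 2 * d + (12 * t + 543) * d ^+ 2.
  rewrite (_ : 4 * (d * w) + _ = 12 * t ^+ 2 * d + 12 * t * d ^+ 2 + 4 * (d ^+ 2 * d) + 11 * (d ^+ 2 * w ^+ 2)); last by rewrite {1}/w; ring.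
  lra.
have := le_trans le (ler_wpM2l (ltW G_gt0) le2).
rewrite (_ : (t + d) ^+ 2 - t ^+ 2 = 2 * t * d + d ^+ 2); last by ring.
lra.
Qed.
End CriticalEquation.

(** Indices are counted from a largest coordinate [t 0], with neighbours [t 1] and [t 6]. A
    reflection of the cycle lets the smaller neighbour take the role of [a] in [critical_cubes]. *)
Lemma cyclic_critical_cubes (R : realFieldType) (s : 'I_7 -> R) :
  (forall i, 0 <= s i) -> (exists i, 0 < s i) ->
  (forall i, s (ord_pred i) ^+ 2 + s (ordS i) ^+ 2 = s i) ->
  766 / 1000 <= \sum_i s i ^+ 3.
Proof.
move=> s0 [j sj] crit.
have [i0 _ max] := @Order.TotalTheory.arg_maxP _ _ _ ord0 predT s isT.
have M0 : 0 < s i0 by apply: lt_le_trans sj (max _ isT).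
pose t (k : nat) := s (iter k (@ordS 7) i0).
have itE k : iter k (@ordS 7) i0 = ((i0 + k) %% 7)%N :> nat.
  elim: k => [|k IH]; first by rewrite addn0 modn_small.
  by rewrite iterS [LHS]/= IH -addn1 modnDml addn1 addnS.
have it7 : iter 7 (@ordS 7) i0 = i0 by apply: ord_inj; rewrite itE modnDr modn_small.
have t7 : t 7%N = t 0%N by rewrite /t it7.
have tS k : t k ^+ 2 + t k.+2 ^+ 2 = t k.+1.
  by have := crit (iter k.+1 (@ordS 7) i0); rewrite /= ordSK.
have t8 : t 8%N = t 1%N by rewrite /t -[8%N]/(1 + 7)%N iterD it7.
have tmax k : t k <= t 0%N by apply: max.
have t_ge0 k : 0 <= t k by apply: s0.
have -> : \sum_i s i ^+ 3 = t 0 ^+ 3 + t 1 ^+ 3 + t 6 ^+ 3 + t 2 ^+ 3 + t 5 ^+ 3 + t 3 ^+ 3 + t 4 ^+ 3.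
  pose f (k : 'I_7) := iter k (@ordS 7) i0.
  have f_inj : injective f.
    move=> k l /(congr1 (@nat_of_ord 7)); rewrite !itE => /eqP; rewrite eqn_modDl !modn_small //.
    by move=> /eqP /ord_inj.
  rewrite (reindex_inj f_inj) /= (eq_bigr (fun k : 'I_7 => t k ^+ 3)) //.
  by rewrite !big_ord_recl big_ord0 /=; ring.
have e1 := tS 0%N; have e2 := tS 1%N; have e3 := tS 2%N; have e4 := tS 3%N.
have e5 := tS 4%N; have e6 := tS 5%N; have e7 := tS 6%N.
rewrite t7 in e6 e7; rewrite t8 in e7.
have comm a b c : a ^+ 2 + b ^+ 2 = c -> b ^+ 2 + a ^+ 2 = c :> R by rewrite addrC.
case: (leP (t 1%N) (t 6%N)) => [le|/ltW le].
  exact: (@critical_cubes _ (t 0) (t 1) (t 6) (t 2) (t 5) (t 3) (t 4) M0 (And3 _ _ _) (And3 _ _ _)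
    le (tmax _) (comm _ _ _ e7) e1 (comm _ _ _ e6) e2 (comm _ _ _ e5)).
rewrite (_ : _ + _ + _ = t 0 ^+ 3 + t 6 ^+ 3 + t 1 ^+ 3 + t 5 ^+ 3 + t 2 ^+ 3 + t 4 ^+ 3 + t 3 ^+ 3); last by ring.
exact: (@critical_cubes _ (t 0) (t 6) (t 1) (t 5) (t 2) (t 4) (t 3) M0 (And3 _ _ _) (And3 _ _ _)
  le (tmax _) e7 (comm _ _ _ e6) e1 (comm _ _ _ e5) e2).
Qed.

(** The form [Q] of the opening comment; [cubes] is [N]. *)
Definition quartic (R : pzRingType) (s : 'I_7 -> R) := \sum_i s i ^+ 2 * s (ordS i) ^+ 2.
Definition cubes (R : pzRingType) (s : 'I_7 -> R) := \sum_i s i ^+ 3.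

(** * The maximum of the quartic form for a fixed sum of cubes *)

Section QuarticCubes.
Variable R : realType.
Implicit Types s : 'I_7 -> R.

Lemma quartic_ge0 s : 0 <= quartic s.
Proof. by apply: sumr_ge0 => i _; rewrite mulr_ge0 // sqr_ge0. Qed.

Lemma quarticZ (k : R) s : quartic (fun i => k * s i) = k ^+ 4 * quartic s.
Proof. by rewrite mulr_sumr; apply: eq_bigr => i _; ring. Qed.

Lemma cubesZ (k : R) s : cubes (fun i => k * s i) = k ^+ 3 * cubes s.
Proof. by rewrite mulr_sumr; apply: eq_bigr => i _; rewrite exprMn. Qed.

Definition update s i x := fun j => if j == i then x else s j.

Lemma cubes_update s i : exists2 n : R, (forall j, 0 <= s j) -> 0 <= n &
  forall x, cubes (update s i x) = x ^+ 3 + n.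
Proof.
exists (\sum_(j | j != i) s j ^+ 3); first by move=> s0; apply: sumr_ge0 => j _; rewrite exprn_ge0.
move=> x; rewrite /cubes (bigD1 i) //= /update eqxx; congr (_ + _).
by apply: eq_bigr => j /negPf ->.
Qed.

Lemma quartic_update s i : exists2 r : R, 0 <= r &
  forall x, quartic (update s i x) = (s (ord_pred i) ^+ 2 + s (ordS i) ^+ 2) * x ^+ 2 + r.
Proof.
exists (\sum_(j | (j != i) && (j != ord_pred i)) s j ^+ 2 * s (ordS j) ^+ 2).
  by apply: sumr_ge0 => j _; rewrite mulr_ge0 // sqr_ge0.
have neq1 : ordS i != i.
  by apply/eqP => /(congr1 (@nat_of_ord 7)) /=; have := ltn_ord i; lia.
have neq2 : ord_pred i != i.
  by apply: contra neq1 => /eqP e; rewrite -{1}e ord_predK.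
move=> x; rewrite /quartic (bigD1 i) //= (bigD1 (ord_pred i)) //= /update.
rewrite eqxx (negPf neq1) (negPf neq2) ord_predK eqxx addrA; congr (_ + _); first by ring.
apply: eq_bigr => j /andP[/negPf -> jp]; case: eqP => // e.
by move: jp; rewrite -e ordSK eqxx.
Qed.

Lemma update_id s i : update s i (s i) = s.
Proof. by apply/funext => j; rewrite /update; case: eqP => // ->. Qed.

(** The nonnegative points with [cubes s = 1] form a compact subset of the unit cube. *)
Lemma quartic_max : exists s, [/\ forall i, 0 <= s i, cubes s = 1 &
  forall t, (forall i, 0 <= t i) -> cubes t = 1 -> quartic t <= quartic s].
Proof.
pose K := [set v : 'rV[R]_7 | forall i, `[0, 1]%classic (v ord0 i)] `&`
  [set v : 'rV[R]_7 | cubes (v ord0) = 1].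
have cont_sum (F : 'I_7 -> 'rV[R]_7 -> R) : (forall i, continuous (F i)) ->
    continuous (fun v => \sum_i F i v).
  move=> cF; apply: continuous_big => //.
  by move=> x; apply: cvgD; [exact: cvg_fst | exact: cvg_snd].
have coordX i k : continuous (fun v : 'rV[R]_7 => v ord0 i ^+ k).
  move=> v; apply: (@continuous_comp _ _ _ (fun v : 'rV[R]_7 => v ord0 i) (fun x : R => x ^+ k)).
    exact: coord_continuous.
  exact: exprn_continuous.
have cK : compact K.
  have box : compact [set v : 'rV[R]_7 | forall i, `[0, 1]%classic (v ord0 i)].
    apply: (@rV_compact R 7 (fun=> `[0, 1]%classic)) => i.
    exact: segment_compact.
  apply: (compact_closedI box).
  apply: (@preimage_closed _ _ (fun v : 'rV[R]_7 => cubes (v ord0)) [set 1]).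
    by move=> v _; apply: cont_sum.
  exact: closed_eq.
have KP s : (forall i, 0 <= s i) -> cubes s = 1 -> K (\row_i s i).
  move=> s0 s1; split=> [i|] /=.
    rewrite mxE in_itv /= s0 /= -(ler_pXn2r (isT : (0 < 3)%N)) ?nnegrE // expr1n -s1.
    by rewrite /cubes (bigD1 i) //= lerDl sumr_ge0 // => j _; rewrite exprn_ge0.
  by rewrite -s1; apply: eq_bigr => i _; rewrite mxE.
have K0 : K !=set0.
  exists (\row_i (if i == ord0 then 1 else 0)); apply: KP => [i|]; first by case: ifP.
  by rewrite /cubes (bigD1 ord0) //= big1 ?expr1n ?addr0 // => i /negPf ->; rewrite expr0n.
have [|v vK vmax] := @compact_EVT_max _ R (fun v : 'rV[R]_7 => quartic (v ord0)) K K0 cK.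
  apply: continuous_subspaceT; apply: cont_sum => i v.
  exact: (continuousM (coordX i 2%N v) (coordX (ordS i) 2%N v)).
move: vK; rewrite inE => -[/= v01 v1].
exists (v ord0); split=> //; first by move=> i; have := v01 i; rewrite in_itv /= => /andP[].
move=> t t0 t1; have := vmax (\row_i t i); rewrite inE => /(_ (KP _ t0 t1)).
congr (_ <= _); apply: eq_bigr => i _; by rewrite !mxE.
Qed.

(** At a maximum [m] of value [G] every coordinate satisfies [critical_equation]. Dividing [m] by
    [2 G] gives a solution of the normalised cyclic equations whose cubes sum to [(2 G)^-3], so this
    is at least 0.766; homogeneity carries the bound on [G] to all [s]. *)
Lemma quartic_le s : (forall i, 0 <= s i) ->
  766 / 1000 * (2 * quartic s) ^+ 3 <= cubes s ^+ 4.
Proof.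
move=> s_ge0; have [m [m0 m1 mmax]] := quartic_max.
set G := quartic m in mmax.
(* Maximality in homogeneous form, of degree 12 on both sides. It holds off the level [cubes t = 1]
   and so allows one coordinate to vary alone. *)
have scale t : (forall i, 0 <= t i) -> quartic t ^+ 3 <= G ^+ 3 * cubes t ^+ 4.
  move=> t0; have c0 : 0 <= cubes t by apply: sumr_ge0 => i _; rewrite exprn_ge0.
  have [y y0 y3] := cube_root c0.
  have [yz|yp] := eqVneq y 0.
    have tz i : t i = 0.
      have : cubes t == 0 by rewrite -y3 yz expr0n.
      rewrite psumr_eq0 => [/allP /(_ i)|j _]; last by rewrite exprn_ge0.
      by rewrite mem_index_enum => /(_ isT); rewrite expf_eq0 /= => /eqP.
    rewrite (_ : quartic t = 0) ?expr0n ?mulr_ge0 ?exprn_ge0 ?quartic_ge0 //.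
    by apply: big1 => i _; rewrite tz expr0n mul0r.
  have := mmax (fun i => y^-1 * t i); rewrite cubesZ -y3 -exprMn mulVf // expr1n.
  move=> /(_ _ erefl); rewrite quarticZ => le.
  have {}le : quartic t <= y ^+ 4 * G.
    rewrite -ler_pdivrMl ?exprn_gt0 ?lt0r ?yp // -exprVn; apply: le => i.
    by rewrite mulr_ge0 ?invr_ge0.
  rewrite -exprM mulnC exprM -exprMn mulrC.
  by apply: lerXn2r; rewrite ?nnegrE ?quartic_ge0 ?mulr_ge0 ?exprn_ge0 // quartic_ge0.
have G0 : 0 < G.
  have := scale (fun=> 1) (fun=> ler01).
  have -> : quartic (fun=> 1 : R) = 7.
    by rewrite /quartic (eq_bigr (fun=> 1)) ?sumr_const ?card_ord // => i _; rewrite expr1n mulr1.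
  rewrite lt0r quartic_ge0 andbT; case: eqP => // ->.
  by rewrite (expr0n _ 3) mul0r => h; exfalso; move: h; rewrite leNgt exprn_gt0.
have crit i : m (ord_pred i) ^+ 2 + m (ordS i) ^+ 2 = 2 * G * m i.
  have [n n0 cE] := cubes_update m i; have [r r0 qE] := quartic_update m i.
  apply: (@critical_equation _ G _ r n) => //; first by rewrite addr_ge0 ?sqr_ge0.
  - exact: n0.
  - by rewrite -qE update_id.
  - by rewrite -cE update_id.
  move=> x x0; rewrite -qE -cE; apply: scale => j.
  by rewrite /update; case: ifP.
have G2 : 0 < 2 * G by lra.
have := @cyclic_critical_cubes R (fun i => (2 * G)^-1 * m i).
rewrite -/(cubes _) cubesZ m1 mulr1 => bound.
have {}bound : 766 / 1000 <= (2 * G)^-1 ^+ 3.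
  apply: bound => [i||i].
  - by rewrite mulr_ge0 // invr_ge0 ltW.
  - apply/existsP; apply: contraT; rewrite negb_exists => /forallP mz.
    have : cubes m = 0.
      apply: big1 => i _; have := mz i; rewrite -leNgt pmulr_rle0 ?invr_gt0 // => mi.
      by rewrite (_ : m i = 0) ?expr0n //; apply/eqP; rewrite eq_le mi m0.
    by rewrite m1 => /eqP; rewrite oner_eq0.
  - rewrite !exprMn -mulrDr crit mulrA; congr (_ * _); rewrite expr2 -mulrA mulVf ?mulr1 //.
    by rewrite gt_eqF.
have {}bound : 766 / 1000 * (2 * G) ^+ 3 <= 1.
  by rewrite -ler_pdivlMr ?exprn_gt0 // mul1r -exprVn.
have k0 : 0 <= 766 / 1000 :> R by lra.
move: (766 / 1000) k0 bound => k k0 bound.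
have c0 : 0 <= cubes s ^+ 4.
  by rewrite exprn_ge0 //; apply: sumr_ge0 => i _; rewrite exprn_ge0.
apply: (@le_trans _ _ (k * (2 * G) ^+ 3 * cubes s ^+ 4)); last by rewrite ler_piMl.
rewrite -[leRHS]mulrA; apply: ler_wpM2l => //.
have -> : (2 * quartic s) ^+ 3 = 8 * quartic s ^+ 3 by ring.
have -> : (2 * G) ^+ 3 * cubes s ^+ 4 = 8 * (G ^+ 3 * cubes s ^+ 4) by ring.
by rewrite ler_pM2l // scale.
Qed.
End QuarticCubes.

(** * Asymptotics *)

Section FactorialBounds.
Variable R : realType.

Lemma fact_lower_bound n : n%:R ^+ n <= n`!%:R * expR n%:R :> R.
Proof.
elim: n => [|n IH]; first by rewrite expr0 fact0 mul1r expR0.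
have step : n.+1%:R ^+ n <= n%:R ^+ n * expR 1 :> R.
  case: n {IH} => [|n]; first by rewrite !expr0 mul1r -expR0 ler_expR.
  have n0 : n.+1%:R != 0 :> R by rewrite pnatr_eq0.
  rewrite (_ : n.+2%:R = n.+1%:R * (1 + n.+1%:R^-1)); last by rewrite mulrDr mulr1 divff // -natr1.
  rewrite exprMn ler_wpM2l ?exprn_ge0 //.
  rewrite (_ : expR 1 = expR n.+1%:R^-1 ^+ n.+1); last by rewrite -expRM_natl divff.
  by apply: lerXn2r; rewrite ?nnegrE ?expR_ge0 ?addr_ge0 ?invr_ge0 // expR_ge1Dx.
rewrite exprS factS natrM -mulrA ler_wpM2l // -[X in expR X]natr1 expRD mulrA.
apply: (le_trans step); rewrite ler_wpM2r // expR_ge0.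
Qed.

(** By induction from [(1 - 1/k)^k <= 1/e]. For positive [n] the factor [n] would do; [n + 1]
    accommodates [n = 0]. *)
Lemma fact_upper_bound n : n`!%:R * expR n%:R <= expR 1 * n.+1%:R * n%:R ^+ n :> R.
Proof.
case: n => [|n]; first by rewrite expr0 fact0 mul1r expR0 !mulr1 -expR0 ler_expR.
suff le : n.+1`!%:R * expR n.+1%:R <= expR 1 * n.+1%:R * n.+1%:R ^+ n.+1 :> R.
  by apply: (le_trans le); rewrite ler_wpM2r ?exprn_ge0 // ler_wpM2l ?expR_ge0 // ler_nat.
elim: n => [|n IH]; first by rewrite expr1 mulr1 mul1r mulr1.
have step : n.+1%:R ^+ n.+2 * expR 1 <= n.+2%:R ^+ n.+2 :> R.
  have n0 : n.+2%:R != 0 :> R by rewrite pnatr_eq0.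
  rewrite (_ : expR 1 = expR n.+2%:R^-1 ^+ n.+2); last by rewrite -expRM_natl divff.
  rewrite -exprMn; apply: lerXn2r; rewrite ?nnegrE ?mulr_ge0 ?expR_ge0 //.
  rewrite -ler_pdivlMr ?expR_gt0 // -expRN.
  apply: le_trans (ler_wpM2l (ler0n _ _) (expR_ge1Dx _)).
  by rewrite mulrDr mulr1 mulrN divff // -[X in _ <= X - 1]natr1 addrK.
rewrite factS natrM -[X in expR X]natr1 expRD.
rewrite (_ : n.+2%:R * _ * _ = n.+2%:R * expR 1 * (n.+1`!%:R * expR n.+1%:R)); last by ring.
apply: (@le_trans _ _ (n.+2%:R * expR 1 * (expR 1 * n.+1%:R * n.+1%:R ^+ n.+1))).
  by rewrite ler_wpM2l ?mulr_ge0 ?expR_ge0.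
rewrite (_ : _ * _ * (_ * _ * _) = expR 1 * n.+2%:R * (n.+1%:R ^+ n.+2 * expR 1)); last by rewrite [n.+1%:R ^+ n.+2]exprS; ring.
by rewrite ler_wpM2l ?mulr_ge0 ?expR_ge0.
Qed.

(** From [y <= expR y] at [y = m c / (k + 1)] with [c = - ln q], raised to the power [k + 1]. *)
Lemma poly_geometric_bound (q : R) (k : nat) : 0 < q -> q < 1 ->
  exists C : R, forall m, (0 < m)%N -> m%:R ^+ k * q ^+ m <= C / m%:R.
Proof.
move=> q0 q1; pose c := - ln q.
have c0 : 0 < c by rewrite oppr_gt0 ln_lt0 // q0.
exists ((k.+1%:R / c) ^+ k.+1) => m m0.
have mR : 0 < m%:R :> R by rewrite ltr0n.
have k0 : k.+1%:R != 0 :> R by rewrite pnatr_eq0.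
have qE : q ^+ m = (expR (m%:R * c))^-1.
  by rewrite -expRN /c mulrN opprK expRM_natl lnK.
rewrite ler_pdivlMr // mulrAC -exprSr qE ler_pdivrMr ?expR_gt0 //.
rewrite (_ : expR _ = expR (m%:R * c / k.+1%:R) ^+ k.+1); last by rewrite -expRM_natl [k.+1%:R * _]mulrC divfK.
rewrite -exprMn; apply: lerXn2r; rewrite ?nnegrE ?mulr_ge0 ?expR_ge0 ?invr_ge0 ?(ltW c0) //.
rewrite -ler_pdivrMl ?divr_gt0 // invf_div.
apply: le_trans (expR_ge1Dx _); rewrite (_ : c / k.+1%:R * m%:R = m%:R * c / k.+1%:R).
  by rewrite lerDr.
by rewrite mulrC mulrA.
Qed.
End FactorialBounds.

(* Multiplied over the colours, with [b_i] summing to [tau] times the sum of the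
   [k_i], the exponential factors amount to the weighted AM-GM inequality. *)
Lemma fact_exp_bound (R : realType) (b tau : R) k : 0 < tau -> (0 < k)%N -> 0 < b ->
  k`!%:R <= expR 1 * k.+1%:R * (k%:R ^+ 2 / b) ^+ k * tau ^+ k * expR (b / tau - k%:R *+ 2).
Proof.
move=> tau0 k0 b0; have kR : 0 < k%:R :> R by rewrite ltr0n.
have kN : k%:R != 0 :> R by rewrite gt_eqF.
have tN : tau != 0 by rewrite gt_eqF.
have bN : b != 0 by rewrite gt_eqF.
have up := fact_upper_bound R k.
have step : b / (k%:R * tau) <= expR (b / (k%:R * tau) - 1).
  by apply: le_trans (expR_ge1Dx _); rewrite addrC subrK.
have stepk : (b / (k%:R * tau)) ^+ k <= expR (b / tau - k%:R).
  rewrite (_ : b / tau - k%:R = k%:R * (b / (k%:R * tau) - 1)); last by field; rewrite kN tN.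
  rewrite expRM_natl; apply: lerXn2r; rewrite ?nnegrE ?expR_ge0 //.
  by rewrite divr_ge0 ?mulr_ge0 ?ltW.
have [a0 aE] : 0 <= k%:R ^+ 2 / b /\ k%:R = k%:R ^+ 2 / b * (tau * (b / (k%:R * tau))).
  by split; [rewrite divr_ge0 ?exprn_ge0 // ltW | field; rewrite kN tN bN].
move: (k%:R ^+ 2 / b) a0 aE => a a0 aE.
rewrite mulr2n opprD addrA expRD expRN mulrA ler_pdivlMr ?expR_gt0 //.
apply: (le_trans up); rewrite -!mulrA ler_pM2l ?expR_gt0 // ler_wpM2l //.
rewrite [in leLHS]aE !exprMn; apply: ler_wpM2l; first exact: exprn_ge0.
by rewrite -exprMn; apply: ler_wpM2l => //; apply: exprn_ge0; exact: ltW.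
Qed.

(** * Choice of the weights for given edge counts *)

Section Weights.
Variables (R : realType) (m : nat) (e : 'I_7 -> nat).
Hypotheses (m_gt0 : (0 < m)%N) (sum_e : (\sum_i e i = 3 * m)%N).

(** The base of the first power is [(7/8)^2 / 0.766 < 1]. The factor [(6m)^(3m) / e^(3m)] also
    occurs in the lower bound for labelled cubic graphs and cancels there; the rest is polynomial in
    [m]. *)
Definition profile_bound : R :=
  (49 / 64 / (766 / 1000)) ^+ m * (6 * m%:R) ^+ (3 * m) / expR (3 * m)%:R
    * (expR 1 ^+ 7 * (3 * m).+1%:R ^+ 7).

(** [s i ^+ 3] is the number of half-edges at colour [i]. The weights satisfy [x i + y i = s i] and
    [x i * y (ordS i) = e_i^2 / b_i], which fits [fact_exp_bound]; the product over the colours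
    leaves [tau ^+ (3 * m)], controlled by [quartic_le]. *)
Lemma exists_weights : exists x y : 'I_7 -> R,
  [/\ forall i, 0 <= x i, forall i, 0 <= y i, 0 < \prod_i (x i * y (ordS i)) ^+ e i &
      (7 / 8 * \sum_i (x i + y i) ^+ 3) ^+ (2 * m) * (\prod_i (e i)`!)%:R
        <= profile_bound * \prod_i (x i * y (ordS i)) ^+ e i].
Proof.
have mR : 0 < m%:R :> R by rewrite ltr0n.
have root i : exists t : R, 0 <= t /\ t ^+ 3 = (e i + e (ord_pred i))%:R.
  by have [t t0 t3] := cube_root (ler0n R (e i + e (ord_pred i))); exists t.
have [s sP] := choice root.
have s0 i : 0 <= s i by case: (sP i).
have s3 i : s i ^+ 3 = (e i + e (ord_pred i))%:R by case: (sP i).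
have s_gt0 i : (0 < e i + e (ord_pred i))%N -> 0 < s i.
  move=> e0; rewrite lt0r s0 andbT; apply: contraTneq e0 => sz.
  by rewrite -(ltr0n R) -s3 sz expr0n ltxx.
(* If [s i = 0] then [e i] and [e (ord_pred i)] are 0 and both quotients are 0 by default, so
   [x i + y i = s i] persists. *)
pose x i : R := (e i)%:R / s i ^+ 2; pose y i : R := (e (ord_pred i))%:R / s i ^+ 2.
pose b i : R := s i ^+ 2 * s (ordS i) ^+ 2.
have x0 i : 0 <= x i by rewrite divr_ge0 ?exprn_ge0.
have y0 i : 0 <= y i by rewrite divr_ge0 ?exprn_ge0.
have xyE i : x i * y (ordS i) = (e i)%:R ^+ 2 / b i.
  by rewrite /x /y /b ordSK (invfM (s i ^+ 2)) mulrACA -expr2.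
have b_gt0 i : (0 < e i)%N -> 0 < b i.
  by move=> ei; apply: mulr_gt0; apply: exprn_gt0; apply: s_gt0; rewrite ?ordSK addn_gt0 ei ?orbT.
have xy_gt0 i : 0 < (x i * y (ordS i)) ^+ e i.
  have [->|ei] := posnP (e i); first by rewrite expr0.
  by rewrite exprn_gt0 // xyE divr_gt0 ?b_gt0 ?exprn_gt0 ?ltr0n.
have xyS i : x i + y i = s i.
  rewrite /x /y -mulrDl -natrD -s3; have [->|sz] := eqVneq (s i) 0; first by rewrite expr0n mul0r.
  by rewrite exprS mulfK // expf_neq0.
have sum_s : cubes s = 6 * m%:R.
  rewrite /cubes (eq_bigr _ (fun i _ => s3 i)) -natr_sum big_split /= sum_e.
  rewrite [X in (_ + X)%N](reindex_inj (@ordS_inj 7)) /=.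
  under eq_bigr => i _ do rewrite ordSK.
  by rewrite sum_e -natrM; congr (_ %:R); lia.
exists x, y; split=> //; first by apply: prodr_gt0.
have -> : \sum_i (x i + y i) ^+ 3 = 6 * m%:R.
  by rewrite -sum_s; apply: eq_bigr => i _; rewrite xyS.
(* This [tau] makes the [b i / tau] add up to [3 * m], the sum of the [e i]. *)
pose g := quartic s; pose tau := g / (3 * m%:R).
have g0 : 0 < g.
  have [i ei] : exists i, (0 < e i)%N.
    apply/existsP; apply: contraT; rewrite negb_exists => /forallP ez.
    have : (\sum_i e i = 0)%N by apply: big1 => i _; apply/eqP; rewrite -leqn0 leqNgt.
    by rewrite sum_e; move: m_gt0; lia.
  apply: lt_le_trans (b_gt0 i ei) _; rewrite /g /quartic (bigD1 i) //= lerDl.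
  by apply: sumr_ge0 => j _; rewrite mulr_ge0 ?sqr_ge0.
have tau0 : 0 < tau by rewrite divr_gt0 // mulr_gt0.
pose f i : R := expR 1 * (3 * m).+1%:R * (x i * y (ordS i)) ^+ e i * tau ^+ e i * expR (b i / tau - (e i)%:R *+ 2).
have fact_le i : (e i)`!%:R <= f i.
  rewrite /f; have [->|ei] := posnP (e i).
    rewrite fact0 !expr0 !mulr1 mul0rn subr0.
    have E1 : 1 <= expR 1 :> R by rewrite -expR0 ler_expR.
    have E2 : 1 <= expR (b i / tau).
      by rewrite -expR0 ler_expR divr_ge0 ?(ltW tau0) // mulr_ge0 ?sqr_ge0.
    have E3 : 1 <= (3 * m).+1%:R :> R by rewrite ler1n.
    by rewrite -[1%:R]mulr1 ler_pM ?mulr_ge0 // -[1%:R]mulr1 ler_pM.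
  rewrite xyE; apply: le_trans (fact_exp_bound tau0 ei (b_gt0 i ei)) _.
  apply: ler_wpM2r; first exact: expR_ge0.
  apply: ler_wpM2r; first by apply/exprn_ge0/ltW.
  apply: ler_wpM2r; first by rewrite -xyE ltW.
  by rewrite ler_wpM2l ?expR_ge0 // ler_nat ltnS -sum_e (bigD1 i) //= leq_addr.
rewrite natr_prod.
have prod_le : \prod_i (e i)`!%:R <= \prod_i f i by apply: ler_prod => i _; rewrite ler0n fact_le.
have prod_f : \prod_i f i = expR 1 ^+ 7 * (3 * m).+1%:R ^+ 7 * \prod_i (x i * y (ordS i)) ^+ e i
    * tau ^+ (3 * m) / expR (3 * m)%:R.
  rewrite /f !big_split /= !prodr_const card_ord.
  rewrite (_ : \prod_i tau ^+ e i = tau ^+ (3 * m)); last by rewrite prodrXr sum_e.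
  congr (_ * _); rewrite -expR_sum -expRN; congr expR.
  rewrite big_split /= -mulr_suml sumrN sumrMnl -natr_sum sum_e -/(quartic s) -/g.
  rewrite /tau invf_div mulrCA divff ?gt_eqF // mulr1 natrM mulr2n.
  by ring.
have k0 : 0 < 766 / 1000 :> R by lra.
have tau3 : tau ^+ 3 <= 6 * m%:R / (766 / 1000).
  have := quartic_le s0; rewrite sum_s -/g; move: (766 / 1000) k0 => k k0 le.
  rewrite ler_pdivlMr // /tau expr_div_n mulrAC ler_pdivrMr ?exprn_gt0 ?mulr_gt0 //.
  have -> : 6 * m%:R * (3 * m%:R) ^+ 3 = (6 * m%:R) ^+ 4 / 8 :> R by field.
  by rewrite ler_pdivlMr // (_ : g ^+ 3 * k * 8 = k * (2 * g) ^+ 3) //; ring.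
rewrite /profile_bound; apply: le_trans (ler_wpM2l _ prod_le) _.
  by rewrite exprn_ge0 // mulr_ge0 // ?mulr_ge0 //; lra.
rewrite prod_f; set P := \prod_i _.
have P0 : 0 < P by apply: prodr_gt0.
set E7 := expR 1 ^+ 7; set M7 := (3 * m).+1%:R ^+ 7; set X := expR _.
move: (766 / 1000) k0 tau3 => k k0 tau3.
have tau3m : tau ^+ (3 * m) <= (6 * m%:R / k) ^+ m.
  rewrite exprM; apply: lerXn2r; rewrite ?nnegrE ?exprn_ge0 ?(ltW tau0) //.
  by rewrite divr_ge0 ?mulr_ge0 ?(ltW k0).
have -> : (49 / 64 / k) ^+ m * (6 * m%:R) ^+ (3 * m) / X * (E7 * M7) * P =
  (7 / 8 * (6 * m%:R)) ^+ (2 * m) * (E7 * M7 * P * (6 * m%:R / k) ^+ m / X).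
  rewrite !(exprM _ 3%N) !(exprM _ 2%N).
  have -> : (49 / 64 / k) ^+ m * (6 * m%:R) ^+ 3 ^+ m = (7 / 8 * (6 * m%:R)) ^+ 2 ^+ m * (6 * m%:R / k) ^+ m.
    by rewrite -!exprMn; congr (_ ^+ m); field; rewrite gt_eqF.
  by ring.
apply: ler_wpM2l; first by rewrite exprn_ge0 // mulr_ge0 // ?mulr_ge0 //; lra.
apply: ler_wpM2r; first by rewrite invr_ge0 expR_ge0.
apply: ler_wpM2l => //; rewrite mulr_ge0 ?(ltW P0) // mulr_ge0 ?exprn_ge0 ?expR_ge0 //.
Qed.
End Weights.

(** * Comparison of the two counts and the limit *)

Lemma card_homomorphic_le (R : realType) m : (0 < m)%N ->
  (#|cubic_graphs m.*2 :&: [set E | homomorphic E (cycle_graph 7)]%SET| * 36 ^ m)%:R <=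
  ((6 * m).+1 ^ 7)%:R * profile_bound R m.
Proof.
move=> m0; have cT : #|'I_m.*2| = (2 * m)%N by rewrite card_ord mul2n.
have := first_moment R 'I_m.*2; rewrite cT expnM => /le_trans; apply.
have k0 : 0 < 766 / 1000 :> R by lra.
have B0 : 0 <= profile_bound R m.
  rewrite /profile_bound; move: (766 / 1000) k0 => k k0.
  do !apply: mulr_ge0; rewrite ?invr_ge0 ?exprn_ge0 ?expR_ge0 ?mulr_ge0 //.
  by rewrite invr_ge0 ltW.
have := @sum_balanced_le R 'I_m.*2 _ B0; rewrite cT mulnA; apply=> e sum_e.
apply: exists_weights => //; lia.
Qed.

Lemma card_cubic_graphs_ge (R : realType) m : (1 < m)%N ->
  (6 * m%:R) ^+ (3 * m) / expR (3 * m)%:R <= (18 * m ^ 4 * #|cubic_graphs m.*2| * 36 ^ m)%:R :> R.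
Proof.
move=> m1; rewrite ler_pdivrMr ?expR_gt0 //.
have lower : (6 ^ m * m`! ^ 3)%:R <= (18 * m ^ 4 * #|cubic_graphs m.*2|)%:R :> R.
  by rewrite ler_nat card_cubic_lower_bound.
apply: (@le_trans _ _ ((6 ^ m * m`! ^ 3 * 36 ^ m)%:R * expR (3 * m)%:R)); last first.
  by rewrite ler_wpM2r ?expR_ge0 // natrM [leRHS]natrM ler_wpM2r.
have fl : m%:R ^+ m ^+ 3 <= (m`!%:R * expR m%:R) ^+ 3 :> R.
  by apply: lerXn2r; rewrite ?nnegrE ?mulr_ge0 ?expR_ge0 ?exprn_ge0 // fact_lower_bound.
rewrite (_ : (6 * m%:R) ^+ (3 * m) = (6 ^+ m * 36 ^+ m) * m%:R ^+ m ^+ 3 :> R); last first.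
  have -> : m%:R ^+ m ^+ 3 = m%:R ^+ (3 * m) :> R by rewrite -exprM mulnC.
  rewrite exprMn; congr (_ * _).
  by rewrite exprM -exprMn; congr (_ ^+ m); ring.
rewrite (_ : (6 ^ m * m`! ^ 3 * 36 ^ m)%:R * expR (3 * m)%:R = (6 ^+ m * 36 ^+ m) * (m`!%:R * expR m%:R) ^+ 3).
  by rewrite ler_wpM2l // mulr_ge0 ?exprn_ge0.
by rewrite [(3 * m)%:R]natrM expRM_natl !natrM !natrX exprMn; ring.
Qed.

Lemma prob_cubic_hom_le (R : realType) : exists C : R, forall m, (1 < m)%N ->
  prob_cubic_hom R m.*2 (cycle_graph 7) <= C / m%:R.
Proof.
(* The margin is narrow: [49/64 = 0.765625]. *)
pose q : R := 49 / 64 / (766 / 1000).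
have q0 : 0 < q by rewrite /q; lra.
have q1 : q < 1 by rewrite /q; lra.
(* The degree is [18 = 7 + 7 + 4]: the number of count vectors, the factors [3m + 1] from the seven
   factorials, and [m^4] from the lower bound for cubic graphs. *)
have [C0 C0P] := @poly_geometric_bound R q 18 q0 q1.
(* The bases 7 and 4 come from [6m + 1 <= 7m] and [3m + 1 <= 4m]. *)
pose D : R := 18 * 7 ^+ 7 * 4 ^+ 7 * expR 1 ^+ 7.
have D0 : 0 <= D by rewrite /D !mulr_ge0 ?exprn_ge0 ?expR_ge0.
exists (D * C0) => m m1; have m0 : (0 < m)%N by lia.
have mR : 0 < m%:R :> R by rewrite ltr0n.
have up := card_homomorphic_le R m0; have low := card_cubic_graphs_ge R m1.
rewrite /prob_cubic_hom /uniform_prob.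
set bad := #|_| in up *; set g := #|_| in low *.
have g0 : (0 < g)%N.
  rewrite lt0n; apply: contraTneq low => ->; rewrite muln0 mul0n -ltNge.
  by rewrite divr_gt0 ?expR_gt0 ?exprn_gt0 ?mulr_gt0.
rewrite ler_pdivrMr ?ltr0n //.
have c0 : 0 < (36 ^ m)%:R :> R by rewrite ltr0n expn_gt0.
rewrite -(ler_pM2r c0) -natrM; apply: (le_trans up).
rewrite /profile_bound -/q.
move: low; set L := _ / expR _ => low.
rewrite (_ : q ^+ m * _ * _ * _ = L * (q ^+ m * (expR 1 ^+ 7 * (3 * m).+1%:R ^+ 7))); last by rewrite /L; ring.
have rest0 : 0 <= q ^+ m * (expR 1 ^+ 7 * (3 * m).+1%:R ^+ 7).
  by rewrite !mulr_ge0 ?exprn_ge0 ?expR_ge0 ?(ltW q0).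
apply: (le_trans (ler_wpM2l (ler0n _ _) (ler_wpM2r rest0 low))).
have le6 : ((6 * m).+1 ^ 7)%:R <= 7 ^+ 7 * m%:R ^+ 7 :> R.
  by rewrite -exprMn -natrM -natrX ler_nat leq_exp2r //; lia.
have le3 : (3 * m).+1%:R ^+ 7 <= 4 ^+ 7 * m%:R ^+ 7 :> R.
  by rewrite -exprMn -natrM -!natrX ler_nat leq_exp2r //; lia.
have gc0 : 0 <= g%:R * (36 ^ m)%:R :> R by rewrite mulr_ge0.
apply: (@le_trans _ _ (D * (m%:R ^+ 18 * q ^+ m) * (g%:R * (36 ^ m)%:R))); last first.
  rewrite (_ : D * C0 / m%:R * g%:R * _ = D * (C0 / m%:R) * (g%:R * (36 ^ m)%:R)); last by ring.
  by rewrite ler_wpM2r // ler_wpM2l // C0P.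
have q0m : 0 <= q ^+ m by rewrite exprn_ge0 // ltW.
have E0 : 0 <= expR 1 ^+ 7 :> R by rewrite exprn_ge0 ?expR_ge0.
rewrite 2!natrM [(18 * _)%:R]natrM natrX.
move: le6 le3; set a := ((6 * m).+1 ^ 7)%:R; set b := (3 * m).+1%:R ^+ 7 => le6 le3.
have a0 : 0 <= a by []; have b0 : 0 <= b by rewrite exprn_ge0.
have ab : a * b <= 7 ^+ 7 * m%:R ^+ 7 * (4 ^+ 7 * m%:R ^+ 7) by apply: ler_pM.
have K0 : 0 <= 18 * m%:R ^+ 4 * (g%:R * (36 ^ m)%:R) * (q ^+ m * expR 1 ^+ 7) :> R.
  apply: mulr_ge0; last exact: mulr_ge0.
  by apply: mulr_ge0 => //; apply: mulr_ge0 => //; apply: exprn_ge0.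
set X := (X in X <= _); set Y := (X in _ <= X).
have -> : X = 18 * m%:R ^+ 4 * (g%:R * (36 ^ m)%:R) * (q ^+ m * expR 1 ^+ 7) * (a * b) by rewrite /X; ring.
apply: (le_trans (ler_wpM2l K0 ab)); rewrite le_eqVlt; apply/orP; left; apply/eqP.
by rewrite /Y /D; ring.
Qed.

Theorem theorem2 (R : realType) :
  prob_cubic_hom R n (cycle_graph 7) @[n --> within [set n | ~~ odd n] \oo]
    --> (0 : R).
Proof.
have [C CP] := prob_cubic_hom_le R.
apply/cvgr0Pnorm_lt => eps eps0; rewrite near_withinE.
(* For [n = 2m] with [m >= N > C / eps] the bound [C / m] is below [eps]; [n >= 4] ensures
   [m > 1]. *)
pose N := (Num.truncn (C / eps)).+1.
exists (maxn 4 N.*2) => // n /= nN even_n.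
have n_half : n = n./2.*2 by rewrite -[LHS]odd_double_half (negPf even_n).
move: nN; rewrite n_half geq_max => /andP[n4 nN].
have m1 : (1 < n./2)%N by move: n4; lia.
have mN : (N <= n./2)%N by move: nN; lia.
rewrite ger0_norm; last by rewrite divr_ge0.
apply: (le_lt_trans (CP _ m1)); rewrite ltr_pdivrMr ?ltr0n; last by lia.
rewrite -ltr_pdivrMl // mulrC; apply: lt_le_trans (truncnS_gt _) _.
by rewrite ler_nat.
Qed.
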